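(* For any finite group $G$ and any complete set of ordered $G$-orbits $\mathfrak O$, the operad $\mathcal Q_{G,\mathfrak O}$ in $G$-categories is an $E_\infty$ $G$-operad, and the inclusion $\mathcal Q_{G,\mathfrak O}\hookrightarrow\mathcal P_G$ is an equivalence of $G$-operads.
   Context: **Permutations.** $\Sigma_n$ is the symmetric group on $\{1,\dots,n\}$, with product $\sigma\tau$ meaning ''first $\tau$, then $\sigma$''. For $\sigma\in\Sigma_n$ and $k_1,\dots,k_n\ge 0$ with $k=k_1+\dots+k_n$, split $\{1,\dots,k\}$ into $n$ consecutive (possibly empty) blocks of sizes $k_1,\dots,k_n$. The block permutation $\sigma\langle k_1,\dots,k_n\rangle\in\Sigma_k$ permutes the blocks according to $\sigma$: it sends the $i$-th element of the $j$-th block to $i+\sum_{l:\sigma(l)<\sigma(j)}k_l$. For $\tau_j\in\Sigma_{k_j}$, the block sum $\tau_1\oplus\dots\oplus\tau_n\in\Sigma_k$ permutes by $\tau_j$ within the $j$-th block. Put $\sigma\langle\tau_1,\dots,\tau_n\rangle=\sigma\langle k_1,\dots,k_n\rangle\cdot(\tau_1\oplus\dots\oplus\tau_n)$. **The operad $P_G$.** For a finite group $G$, $P_G$ is the (symmetric) operad in $G$-sets with $P_G(n)$ the set of all functions $f\colon G\to\Sigma_n$ (not necessarily homomorphisms), for $n\ge 0$. The left $G$-action is $(g\cdot f)(h)=f(hg)$, the right $\Sigma_n$-action is $(f\cdot\sigma)(h)=f(h)\sigma$, the composition is $\gamma(f;f_1,\dots,f_n)(h)=f(h)\langle f_1(h),\dots,f_n(h)\rangle$,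 and the operadic identity is the unique element $\mathbb 1\in P_G(1)$. **Chaotic categories and $\mathcal P_G$.** For a set $X$, $\widetilde X$ is the category with object set $X$ and exactly one morphism between any two objects. Applied levelwise, $\widetilde{(-)}$ preserves products and turns operads in $G$-sets into operads in $G$-categories (small categories with a strict $G$-action). Put $\mathcal P_G=\widetilde{P_G}$ (the categorical $G$-Barratt–Eccles operad). **Suboperads.** A suboperad of an operad $\mathcal O$ in $G$-sets consists of subsets of the $\mathcal O(n)$ closed under the $G$- and $\Sigma_n$-actions, containing the operadic identity and closed under composition; $\langle S\rangle$ denotes the smallest suboperad containing a given collection $S$ of elements. **Norms.** For a finite ordered $G$-set $T=\{t_1<\dots<t_n\}$, let $\otimes_T\colon G\to\Sigma_n$ be its permutation representation ($g\cdot t_i=t_{\otimes_T(g)(i)}$), regarded as an element of $P_G(n)$. **Complete sets and $\mathcal Q_{G,\mathfrak O}$.** A set $\mathfrak O$ of ordered transitive $G$-sets is a *complete set of ordered $G$-orbits* if it contains exactly one non-trivial transitive $G$-set of each isomorphism class (forgetting the ordering). Given such an $\mathfrak O$, let $$Q_{G,\mathfrak O}=\langle\otimes_T\mid T\in\mathfrak O\cup\{\varnothing,\{0,1\}\}\rangle\subseteq P_G,$$ where $\{0,1\}$ has trivial $G$-action and $0<1$; let $\mathcal Q_{G,\mathfrak O}=\widetilde{Q_{G,\mathfrak O}}$, a full suboperad of $\mathcal P_G$. **Homotopy notions.** For an operad $\mathcal O$ in $G$-categories, view $\mathcal O(n)$ as a left $G\times\Sigma_n$-category via $(g,\sigma)\cdot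 x=g\cdot x\cdot\sigma^{-1}$. A map of operads $f\colon\mathcal N\to\mathcal O$ in $G$-categories is an *equivalence* if for all $n\geq 0$ and all subgroups $\Gamma\le G\times\Sigma_n$ the map of fixed points $f_n^\Gamma\colon\mathcal N(n)^\Gamma\to\mathcal O(n)^\Gamma$ becomes a weak homotopy equivalence on classifying spaces. $\mathcal O$ is a (genuine) *$E_\infty$ $G$-operad* if on classifying spaces it is an $N_\infty$ operad containing all norms, i.e. for every $n\ge0$ and $\Gamma\le G\times\Sigma_n$, the classifying space of $\mathcal O(n)^\Gamma$ is contractible if $\Gamma\cap(\{1\}\times\Sigma_n)$ is trivial, and is empty otherwise. *)

(* Defs.v *)
From HB Require Import structures.
From Stdlib Require Import Relations.
From mathcomp Require Import all_boot all_order all_algebra all_fingroup.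
From mathcomp Require Import generic_quotient.
From mathcomp Require Import boolp classical_sets reals topology normedtype.

Set Implicit Arguments.
Unset Strict Implicit.
Unset Printing Implicit Defensive.

Import Order.TTheory GRing.Theory Num.Theory.
Import numFieldNormedType.Exports.

(** [Sym n] is ['S_n] with the product [s * t] = "first [t], then [s]", which is the
    opposite of the product of ['S_n] in the library. *)
Definition Sym (n : nat) : Type := 'S_n.

HB.instance Definition _ n := Finite.copy (Sym n) 'S_n.

Section SymGroup.
Variable n : nat.
Implicit Types s t u : Sym n.

Definition sym_mul s t : Sym n := (t * s : 'S_n)%g.
Definition sym_one : Sym n := (1 : 'S_n)%g.
Definition sym_inv s : Sym n := (s^-1 : 'S_n)%g.

Fact sym_mulA : associative sym_mul.
Proof. by move=> s t u; rewrite /sym_mul mulgA. Qed.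
Fact sym_mul1 : left_id sym_one sym_mul.
Proof. by move=> s; rewrite /sym_mul /sym_one mulg1. Qed.
Fact sym_mulV : left_inverse sym_one sym_inv sym_mul.
Proof. by move=> s; rewrite /sym_mul /sym_inv /sym_one mulgV. Qed.

HB.instance Definition _ :=
  Finite_isGroup.Build (Sym n) sym_mulA sym_mul1 sym_mulV.
End SymGroup.

Lemma symME n (s t : Sym n) i : (s * t)%g i = s (t i).
Proof. exact: (permM (t : 'S_n) (s : 'S_n)). Qed.
Lemma sym1E n i : (1%g : Sym n) i = i.
Proof. exact: perm1. Qed.
Lemma symVK n (s : Sym n) i : s^-1%g (s i) = i.
Proof. by rewrite -symME mulVg sym1E. Qed.
Lemma symKV n (s : Sym n) i : s (s^-1%g i) = i.
Proof. by rewrite -symME mulgV sym1E. Qed.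

(** The [j]-th block of ['I_(\sum_i k i)] is the image of [tagnat.Rank j],
    an element [p] being the [tagnat.sig2 p]-th of the block [tagnat.sig1 p]. *)
Section Blocks.
Variables (n : nat) (k : 'I_n -> nat).

Definition block_off (s : Sym n) (j : 'I_n) : nat :=
  \sum_(l < n | s l < s j) k l.

Lemma block_off_le (s : Sym n) (j j' : 'I_n) :
  s j < s j' -> block_off s j + k j <= block_off s j'.
Proof.
move=> lt_jj'; rewrite [leqRHS](bigID [pred l | s l < s j])/=.
apply: leq_add.
  apply: eq_leq; apply: eq_bigl => l.
  by case: (ltnP (s l) (s j)); rewrite ?andbF// => /ltn_trans->.
by rewrite (bigD1 j) ?lt_jj' ?ltnn//= leq_addr.
Qed.

Lemma block_off_lt (s : Sym n) (j : 'I_n) (i : 'I_(k j)) :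
  i + block_off s j < \sum_l k l.
Proof.
rewrite [ltnRHS](bigID [pred l | s l < s j])/= addnC ltn_add2l.
by rewrite (bigD1 j) ?ltnn//= ltn_addr.
Qed.

Definition block_fun (s : Sym n) (p : 'I_(\sum_l k l)) : 'I_(\sum_l k l) :=
  Ordinal (block_off_lt s (tagnat.sig2 p)).

Lemma block_fun_inj s : injective (block_fun s).
Proof.
move=> p q /(congr1 val)/=.
case: (ltngtP (s (tagnat.sig1 p)) (s (tagnat.sig1 q))) => [lt|lt|eq] E.
- have := block_off_le lt; rewrite leqNgt => /negP[].
  apply: (@leq_ltn_trans (tagnat.sig2 p + block_off s (tagnat.sig1 p))).
    by rewrite E leq_addl.
  by rewrite addnC ltn_add2l ltn_ord.
- have := block_off_le lt; rewrite leqNgt => /negP[].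
  apply: (@leq_ltn_trans (tagnat.sig2 q + block_off s (tagnat.sig1 q))).
    by rewrite -E leq_addl.
  by rewrite addnC ltn_add2l ltn_ord.
have epq : tagnat.sig1 p = tagnat.sig1 q by apply: (@perm_inj _ s); apply: val_inj.
have offE : block_off s (tagnat.sig1 p) = block_off s (tagnat.sig1 q).
  by rewrite epq.
move: E; rewrite offE => /addIn E.
apply: val_inj; rewrite /= -[p]tagnat.sig2K -[q]tagnat.sig2K.
by apply/eqP; rewrite tagnat.eq_Rank; apply/andP; split; apply/eqP.
Qed.

Definition block_perm (s : Sym n) : Sym (\sum_l k l) :=
  perm (@block_fun_inj s).

Definition block_sum_fun (t : forall j, Sym (k j)) (p : 'I_(\sum_l k l)) :
  'I_(\sum_l k l) := tagnat.Rank _ (t _ (tagnat.sig2 p)).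

Lemma block_sum_inj t : injective (block_sum_fun t).
Proof.
move=> p q /(congr1 val)/= /eqP.
rewrite tagnat.eq_Rank => /andP[/eqP epq /eqP E].
rewrite -[p]tagnat.sig2K -[q]tagnat.sig2K.
move: E; move: (tagnat.sig2 p) (tagnat.sig2 q); rewrite epq => i i' E.
by congr tagnat.Rank; apply: (@perm_inj _ (t (tagnat.sig1 q))); apply: val_inj.
Qed.

Definition block_sum (t : forall j, Sym (k j)) : Sym (\sum_l k l) :=
  perm (@block_sum_inj t).

Definition sym_comp (s : Sym n) (t : forall j, Sym (k j)) : Sym (\sum_l k l) :=
  (block_perm s * block_sum t)%g.

Lemma block_permE s j (i : 'I_(k j)) :
  block_perm s (tagnat.Rank j i) = i + block_off s j :> nat.
Proof.
rewrite permE /=; congr (_ + _); first by rewrite tagnat.Rank2K.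
by rewrite tagnat.Rank1K.
Qed.

Lemma block_sumE t j (i : 'I_(k j)) :
  block_sum t (tagnat.Rank j i) = tagnat.Rank j (t j i).
Proof.
rewrite permE /block_sum_fun tagnat.Rank2K.
by move: (esym _) => e; case: _ / e; rewrite cast_ord_id.
Qed.

Lemma sym_compE s t j (i : 'I_(k j)) :
  sym_comp s t (tagnat.Rank j i) = t j i + block_off s j :> nat.
Proof. by rewrite symME block_sumE block_permE. Qed.

Lemma block_off1 j : block_off 1%g j = \sum_(l < n | l < j) k l.
Proof. by apply: eq_bigl => l; rewrite !sym1E. Qed.

End Blocks.

(** The operations of a symmetric operad with a [gT]-action on a family [X]
    of sets.  They are also used for the families of objects and of morphisms
    of an operad in [gT]-categories. *)
Record operad_ops (gT : finGroupType) (X : nat -> Type) := OperadOps {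
  opG : forall n, gT -> X n -> X n;
  opS : forall n, X n -> Sym n -> X n;
  op1 : X 1;
  opC : forall n (k : 'I_n -> nat),
    X n -> (forall i, X (k i)) -> X (\sum_(i < n) k i)
}.

(** An equation between elements of [X m] and [X n], where [m] and [n] are
    only provably equal, is stated in the total space [{n & X n}].
    [op_eqv_outer] is the usual axiom
    [(x.s)(y_1,...,y_n) = x(y_(s^-1 1),...,y_(s^-1 n)) . s<k_1,...,k_n>],
    with the block permutation moved to the left-hand side. *)
Record operad_laws (gT : finGroupType) (X : nat -> Type)
    (o : operad_ops gT X) : Prop := OperadLaws {
  opG_1 : forall n (x : X n), opG o 1%g x = x;
  opG_M : forall n g h (x : X n), opG o (g * h)%g x = opG o g (opG o h x);
  opS_1 : forall n (x : X n), opS o x 1%g = x;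
  opS_M : forall n (x : X n) s t, opS o x (s * t)%g = opS o (opS o x s) t;
  opG_S : forall n g (x : X n) s, opG o g (opS o x s) = opS o (opG o g x) s;
  opG_op1 : forall g, opG o g (op1 o) = op1 o;
  opG_opC : forall n (k : 'I_n -> nat) g x (y : forall i, X (k i)),
    opG o g (opC o x y) = opC o (opG o g x) (fun i => opG o g (y i));
  op_unitl : forall n (x : X n),
    Tagged X (opC o (op1 o) (fun _ : 'I_1 => x)) = Tagged X x;
  op_unitr : forall n (x : X n),
    Tagged X (opC o x (fun _ : 'I_n => op1 o)) = Tagged X x;
  op_assoc : forall n (k : 'I_n -> nat) (m : 'I_(\sum_(i < n) k i) -> nat)
      x (y : forall i, X (k i)) (z : forall p, X (m p)),
    Tagged X (opC o (opC o x y) z) =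
    Tagged X (opC o x (fun i => opC o (y i) (fun j => z (tagnat.Rank i j))));
  op_eqv_outer : forall n (k : 'I_n -> nat) x s (y : forall i, X (k i)),
    Tagged X (opS o (opC o (opS o x s) y) (block_perm k s)^-1%g) =
    Tagged X (opC o x (fun i => y (s^-1%g i)));
  op_eqv_inner : forall n (k : 'I_n -> nat) x (y : forall i, X (k i))
      (t : forall i, Sym (k i)),
    opC o x (fun i => opS o (y i) (t i)) = opS o (opC o x y) (block_sum t)
}.

Record gset_operad (gT : finGroupType) := GSetOperad {
  go_sort :> nat -> Type;
  go_ops : operad_ops gT go_sort;
  go_laws : operad_laws go_ops
}.

Lemma tagged_sym_eq m n (s : Sym m) (t : Sym n) : m = n ->
  (forall (i : 'I_m) (j : 'I_n), i = j :> nat -> s i = t j :> nat) ->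
  Tagged Sym s = Tagged Sym t.
Proof.
move=> e; case: _ / e t => t st; congr (Tagged Sym _).
by apply/permP => i; apply: val_inj; apply: st.
Qed.

Lemma big_Rank n (k : 'I_n -> nat) (P : pred 'I_(\sum_i k i))
    (F : 'I_(\sum_i k i) -> nat) :
  \sum_(p | P p) F p =
  \sum_(i < n) \sum_(j < k i | P (tagnat.Rank i j)) F (tagnat.Rank i j).
Proof.
rewrite (reindex (@tagnat.rank n k)) /=; last exact: (onW_bij _ tagnat.rank_bij).
rewrite (sig_big_dep _ _ (fun (i : 'I_n) (j : 'I_(k i)) => F (tagnat.Rank i j)))/=.
by apply: eq_big => [[i j]|[i j] _].
Qed.

Lemma Rank_ind n (k : 'I_n -> nat) (P : 'I_(\sum_i k i) -> Prop) :
  (forall i (j : 'I_(k i)), P (tagnat.Rank i j)) -> forall p, P p.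
Proof. by move=> H p; rewrite -[p]tagnat.sig2K. Qed.

Lemma eq_block_off n (k k' : 'I_n -> nat) s j :
  k =1 k' -> block_off k s j = block_off k' s j.
Proof. by move=> e; apply: eq_bigr => i _; rewrite e. Qed.

Lemma block_off_comp n (k : 'I_n -> nat) (m : 'I_(\sum_i k i) -> nat)
    (s : Sym n) (t : forall i, Sym (k i)) i (j : 'I_(k i)) :
  block_off m (sym_comp s t) (tagnat.Rank i j) =
  block_off (fun i' => \sum_j m (tagnat.Rank i' j)) s i +
  block_off (fun j => m (tagnat.Rank i j)) (t i) j.
Proof.
rewrite /block_off big_Rank (bigID [pred l | s l < s i])/=; congr (_ + _).
  apply: eq_bigr => l lt; apply: eq_bigl => j'; rewrite !sym_compE.
  apply: (@leq_trans (block_off k s l + k l)).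
    by rewrite addnC ltn_add2l.
  by apply: leq_trans (block_off_le _ lt) _; rewrite leq_addl.
rewrite (bigD1 i) ?ltnn//= [X in _ + X]big1 ?addn0.
  by apply: eq_bigl => j'; rewrite !sym_compE ltn_add2r.
move=> l /andP[nlt neq]; rewrite big1// => j'; rewrite !sym_compE.
have lt : s i < s l.
  by rewrite ltn_neqAle leqNgt nlt andbT eq_sym val_eqE (inj_eq perm_inj).
have := block_off_le k lt => le.
rewrite ltnNge => /negP[]; apply: ltnW.
apply: leq_trans (leq_trans _ le) (leq_addl _ _).
by rewrite addnC ltn_add2l.
Qed.

Lemma sym_comp1 n (k : 'I_n -> nat) :
  sym_comp 1%g (fun i => 1%g : Sym (k i)) = 1%g.
Proof.
apply/permP; apply: Rank_ind => i j; apply: ord_inj.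
by rewrite sym_compE !sym1E tagnat.RankEsum block_off1 addnC.
Qed.

Lemma sym_assoc n (k : 'I_n -> nat) (m : 'I_(\sum_(i < n) k i) -> nat)
    (s : Sym n) (t : forall i, Sym (k i)) (u : forall p, Sym (m p)) :
  Tagged Sym (sym_comp (sym_comp s t) u) =
  Tagged Sym (sym_comp s (fun i => sym_comp (t i) (fun j => u (tagnat.Rank i j)))).
Proof.
apply: tagged_sym_eq; first by rewrite [LHS]big_Rank.
move=> x; elim/Rank_ind => i; elim/Rank_ind => j a.
move=> ex; have {ex} -> : x = tagnat.Rank (tagnat.Rank i j) a.
  have offE := block_off_comp m 1%g (fun i => 1%g : Sym (k i)) j.
  rewrite sym_comp1 in offE.
  apply: ord_inj; rewrite ex [RHS]tagnat.RankEsum.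
  rewrite -[X in _ = X + _]block_off1 offE.
  by rewrite !tagnat.RankEsum -!block_off1 addnA.
rewrite !sym_compE block_off_comp -addnA; congr (_ + _).
by rewrite addnC.
Qed.

Lemma sym_unitl n (s : Sym n) :
  Tagged Sym (sym_comp 1%g (fun _ : 'I_1 => s)) = Tagged Sym s.
Proof.
apply: tagged_sym_eq; first by rewrite big_ord1.
elim/Rank_ind => i j j'; rewrite tagnat.RankEsum -block_off1 sym_compE.
have off0 : block_off (fun _ : 'I_1 => n) 1%g i = 0.
  by rewrite block_off1 big1// => l; rewrite !ord1.
by rewrite off0 add0n addn0 => /val_inj->.
Qed.

Lemma sym_unitr n (s : Sym n) :
  Tagged Sym (sym_comp s (fun _ : 'I_n => 1%g : Sym 1)) = Tagged Sym s.
Proof.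
apply: tagged_sym_eq; first by rewrite sum1_card card_ord.
have off (t : Sym n) (i : 'I_n) : block_off (fun=> 1%N) t i = t i.
  rewrite /block_off (reindex_inj (@perm_inj _ t^-1%g)) /=.
  rewrite (eq_bigl (fun l : 'I_n => l < t i)); last first.
    by move=> l; rewrite symKV.
  by rewrite -(big_ord_widen _ (fun=> 1%N)) ?sum1_card ?card_ord// ltnW.
elim/Rank_ind => i j j'; rewrite tagnat.RankEsum -block_off1 sym_compE !off.
by rewrite !ord1 sym1E !addn0 add0n => /val_inj->.
Qed.

Lemma sym_eqv_outer n (k : 'I_n -> nat) (s u : Sym n)
    (t : forall i, Sym (k i)) :
  Tagged Sym (sym_comp (s * u)%g t * (block_perm k u)^-1)%g =
  Tagged Sym (sym_comp s (fun i => t (u^-1%g i))).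
Proof.
apply: tagged_sym_eq; first by rewrite [LHS](reindex_inj (@perm_inj _ u^-1%g)).
have off (v w : Sym n) i :
    block_off (fun i => k (v^-1%g i)) w i = block_off k (w * v)%g (v^-1%g i).
  rewrite /block_off [RHS](reindex_inj (@perm_inj _ v^-1%g)) /=.
  by apply: eq_bigl => l; rewrite !symME !symKV.
move=> x; elim/Rank_ind => i j ex.
have -> : x = block_perm k u (tagnat.Rank (u^-1%g i) j).
  by apply: ord_inj; rewrite ex block_permE tagnat.RankEsum -block_off1 off mul1g addnC.
by rewrite symME symVK !sym_compE off.
Qed.

Lemma sym_eqv_inner n (k : 'I_n -> nat) (s : Sym n) (t u : forall i, Sym (k i)) :
  sym_comp s (fun i => t i * u i)%g = (sym_comp s t * block_sum u)%g.
Proof.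
apply/permP; apply: Rank_ind => i j; apply: ord_inj.
by rewrite sym_compE !symME !block_sumE block_permE.
Qed.

Section PG.
Variable gT : finGroupType.

Definition PG (n : nat) : Type := {ffun gT -> Sym n}.

Definition PG_ops : operad_ops gT PG :=
  @OperadOps gT PG
    (fun n g f => [ffun h => f (h * g)%g])
    (fun n f s => [ffun h => (f h * s)%g])
    [ffun=> 1%g]
    (fun n k f y => [ffun h => sym_comp (f h) (fun i => y i h)]).

Lemma tagged_PG m n (f : PG m) (f' : PG n) :
  (forall h, Tagged Sym (f h) = Tagged Sym (f' h)) -> Tagged PG f = Tagged PG f'.
Proof.
move=> ff'; have e : m = n := congr1 tag (ff' 1%g).
case: _ / e f' ff' => f' ff'; congr (Tagged PG _).
by apply/ffunP => h; apply: eq_from_Tagged (ff' h).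
Qed.

Lemma PG_laws : operad_laws PG_ops.
Proof.
split=> /=.
- by move=> n x; apply/ffunP => h; rewrite ffunE mulg1.
- by move=> n g g' x; apply/ffunP => h; rewrite !ffunE mulgA.
- by move=> n x; apply/ffunP => h; rewrite ffunE mulg1.
- by move=> n x s t; apply/ffunP => h; rewrite !ffunE mulgA.
- by move=> n g x s; apply/ffunP => h; rewrite !ffunE.
- by move=> g; apply/ffunP => h; rewrite !ffunE.
- move=> n k g x y; apply/ffunP => h; rewrite !ffunE; congr sym_comp.
  by apply/functional_extensionality_dep => i; rewrite ffunE.
- by move=> n x; apply: tagged_PG => h; rewrite !ffunE sym_unitl.
- move=> n x; apply: tagged_PG => h; rewrite !ffunE -[RHS]sym_unitr.
  by congr (Tagged _ (sym_comp _ _)); apply/funext => i; rewrite ffunE.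
- move=> n k m x y z; apply: tagged_PG => h; rewrite !ffunE sym_assoc.
  congr (Tagged _ (sym_comp _ _)).
  by apply/functional_extensionality_dep => i; rewrite ffunE.
- move=> n k x s y; apply: tagged_PG => h; rewrite !ffunE.
  by rewrite sym_eqv_outer.
- move=> n k x y t; apply/ffunP => h; rewrite !ffunE -sym_eqv_inner.
  by congr sym_comp; apply/functional_extensionality_dep => i; rewrite ffunE.
Qed.

Definition PG_operad : gset_operad gT := GSetOperad PG_laws.
End PG.

Section Suboperads.
Variables (gT : finGroupType) (O : gset_operad gT).

Record is_suboperad (S : forall n, set (O n)) : Prop := IsSuboperad {
  subop_G : forall n g (x : O n), S n x -> S n (opG (go_ops O) g x);
  subop_S : forall n (x : O n) s, S n x -> S n (opS (go_ops O) x s);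
  subop_1 : S 1 (op1 (go_ops O));
  subop_C : forall n (k : 'I_n -> nat) (x : O n) (y : forall i, O (k i)),
    S n x -> (forall i, S (k i) (y i)) ->
    S (\sum_(i < n) k i) (opC (go_ops O) x y)
}.

Definition generated (E : forall n, set (O n)) (n : nat) : set (O n) :=
  fun x => forall S, is_suboperad S ->
    (forall m (y : O m), E m y -> S m y) -> S n x.

Lemma generated_suboperad E : is_suboperad (generated E).
Proof.
split.
- by move=> n g x Ex S subS ES; apply: subop_G (Ex S subS ES).
- by move=> n x s Ex S subS ES; apply: subop_S (Ex S subS ES).
- by move=> S subS ES; apply: subop_1.
- move=> n k x y Ex Ey S subS ES; apply: subop_C (Ex S subS ES) _ => // i.
  exact: Ey.
Qed.

Variables (S : forall n, set (O n)) (subS : is_suboperad S).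

Definition subop_sort (n : nat) : Type := {x : O n | @S n x}.

Definition subop_ops : operad_ops gT subop_sort :=
  @OperadOps gT subop_sort
    (fun n g x => exist _ _ (subop_G subS g (svalP x)))
    (fun n x s => exist _ _ (subop_S subS s (svalP x)))
    (exist _ _ (subop_1 subS))
    (fun n k x y => exist _ _ (subop_C subS (svalP x) (fun i => svalP (y i)))).

Lemma subop_eq n (x y : subop_sort n) : sval x = sval y -> x = y.
Proof. exact: eq_sig_hprop. Qed.

Lemma tagged_subop m n (x : subop_sort m) (y : subop_sort n) :
  Tagged O (sval x) = Tagged O (sval y) -> Tagged subop_sort x = Tagged subop_sort y.
Proof.
move=> exy; have e : m = n := congr1 tag exy.
case: _ / e y exy => y exy; congr (Tagged _ _); apply: subop_eq.
exact: eq_from_Tagged exy.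
Qed.

Lemma subop_laws : operad_laws subop_ops.
Proof.
have L := go_laws O; split.
- by move=> *; apply: subop_eq; apply: (opG_1 L).
- by move=> *; apply: subop_eq; apply: (opG_M L).
- by move=> *; apply: subop_eq; apply: (opS_1 L).
- by move=> *; apply: subop_eq; apply: (opS_M L).
- by move=> *; apply: subop_eq; apply: (opG_S L).
- by move=> *; apply: subop_eq; apply: (opG_op1 L).
- by move=> *; apply: subop_eq; apply: (opG_opC L).
- by move=> *; apply: tagged_subop; apply: (op_unitl L).
- by move=> *; apply: tagged_subop; apply: (op_unitr L).
- by move=> *; apply: tagged_subop; apply: (op_assoc L).
- move=> n k x s y; apply: tagged_subop.
  by apply: (@op_eqv_outer _ _ _ L _ _ _ _ (fun i => sval (y i))).
- by move=> *; apply: subop_eq; apply: (op_eqv_inner L).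
Qed.

Definition suboperad : gset_operad gT := GSetOperad subop_laws.
End Suboperads.

(** Small categories are given by a type of objects and a single type of
    morphisms; [cmp e] is "first [f], then [g]" when [e : tgt f = src g]. *)
Record category := Category {
  Ob : Type;
  Mor : Type;
  src : Mor -> Ob;
  tgt : Mor -> Ob;
  idm : Ob -> Mor;
  cmp : forall f g, tgt f = src g -> Mor;
  src_idm : forall x, src (idm x) = x;
  tgt_idm : forall x, tgt (idm x) = x;
  src_cmp : forall f g (e : tgt f = src g), src (cmp e) = src f;
  tgt_cmp : forall f g (e : tgt f = src g), tgt (cmp e) = tgt g;
  cmp_idl : forall f (e : tgt (idm (src f)) = src f), cmp e = f;
  cmp_idr : forall f (e : tgt f = src (idm (tgt f))), cmp e = f;
  cmp_assoc : forall f g h (e1 : tgt f = src g) (e2 : tgt g = src h)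
      (e3 : tgt (cmp e1) = src h) (e4 : tgt f = src (cmp e2)),
    cmp e3 = cmp e4
}.

Record functor (C D : category) := Functor {
  fob : Ob C -> Ob D;
  fmor : Mor C -> Mor D;
  fsrc : forall f, src (fmor f) = fob (src f);
  ftgt : forall f, tgt (fmor f) = fob (tgt f);
  fidm : forall x, fmor (idm x) = idm (fob x);
  fcmp : forall f g (e : tgt f = src g) (e' : tgt (fmor f) = src (fmor g)),
    fmor (cmp e) = cmp e'
}.

Lemma functor_eq C D (F G : functor C D) :
  fob F =1 fob G -> fmor F =1 fmor G -> F = G.
Proof.
case: F G => [o m h1 h2 h3 h4] [o' m' h1' h2' h3' h4'] /= /funext eo /funext em.
case: _ / eo in h1' h2' h3' h4' *; case: _ / em in h1' h2' h3' h4' *.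
by congr Functor; exact: Prop_irrelevance.
Qed.

Program Definition comp_functor C D E (G : functor D E) (F : functor C D) :
    functor C E :=
  @Functor C E (fob G \o fob F) (fmor G \o fmor F) _ _ _ _.
Next Obligation. by move=> *; rewrite /= !fsrc. Qed.
Next Obligation. by move=> *; rewrite /= !ftgt. Qed.
Next Obligation. by move=> *; rewrite /= !fidm. Qed.
Next Obligation.
move=> C D E G F f g e /= e'.
have e'' : tgt (fmor F f) = src (fmor F g) by rewrite ftgt fsrc e.
by rewrite (fcmp e e'') (fcmp e'' e').
Qed.

Program Definition prod_cat (C D : category) : category :=
  @Category (Ob C * Ob D) (Mor C * Mor D)
    (fun f => (src f.1, src f.2)) (fun f => (tgt f.1, tgt f.2))
    (fun x => (idm x.1, idm x.2))
    (fun f g e => (cmp (congr1 fst e : tgt f.1 = src g.1),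
                   cmp (congr1 snd e : tgt f.2 = src g.2)))
    _ _ _ _ _ _ _.
Next Obligation. by move=> C D [x y] /=; rewrite !src_idm. Qed.
Next Obligation. by move=> C D [x y] /=; rewrite !tgt_idm. Qed.
Next Obligation. by move=> *; rewrite /= !src_cmp. Qed.
Next Obligation. by move=> *; rewrite /= !tgt_cmp. Qed.
Next Obligation. by move=> C D [f g] e /=; rewrite !cmp_idl. Qed.
Next Obligation. by move=> C D [f g] e /=; rewrite !cmp_idr. Qed.
Next Obligation. by move=> *; congr pair; apply: cmp_assoc. Qed.

Program Definition pi_cat (I : Type) (C : I -> category) : category :=
  @Category (forall i, Ob (C i)) (forall i, Mor (C i))
    (fun f i => src (f i)) (fun f i => tgt (f i))
    (fun x i => idm (x i))
    (fun f g e i => cmp (congr1 (fun h => h i) e : tgt (f i) = src (g i)))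
    _ _ _ _ _ _ _.
Next Obligation.
by move=> *; apply/functional_extensionality_dep => i; apply: src_idm.
Qed.
Next Obligation.
by move=> *; apply/functional_extensionality_dep => i; apply: tgt_idm.
Qed.
Next Obligation.
by move=> *; apply/functional_extensionality_dep => i; apply: src_cmp.
Qed.
Next Obligation.
by move=> *; apply/functional_extensionality_dep => i; apply: tgt_cmp.
Qed.
Next Obligation.
by move=> *; apply/functional_extensionality_dep => i; apply: cmp_idl.
Qed.
Next Obligation.
by move=> *; apply/functional_extensionality_dep => i; apply: cmp_idr.
Qed.
Next Obligation.
by move=> *; apply/functional_extensionality_dep => i; apply: cmp_assoc.
Qed.

Program Definition chaotic (X : Type) : category :=
  @Category X (X * X) fst snd (fun x => (x, x)) (fun f g _ => (f.1, g.2))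
    _ _ _ _ _ _ _.
Solve Obligations with by move=> * //=; rewrite -?surjective_pairing.

Definition chaotic_functor (X Y : Type) (u : X -> Y) :
    functor (chaotic X) (chaotic Y) :=
  @Functor (chaotic X) (chaotic Y) u (fun f => (u f.1, u f.2))
    (fun=> erefl) (fun=> erefl) (fun=> erefl) (fun _ _ _ _ => erefl).

Section Fixed.
Variables (C : category) (I : Type) (D : set I) (F : I -> functor C C).

Definition fixed_ob : Type := {x : Ob C | forall i, D i -> fob (F i) x = x}.
Definition fixed_mor : Type := {f : Mor C | forall i, D i -> fmor (F i) f = f}.

Program Definition fixed_cat : category :=
  @Category fixed_ob fixed_mor
    (fun f => exist _ (src (sval f)) _) (fun f => exist _ (tgt (sval f)) _)
    (fun x => exist _ (idm (sval x)) _)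
    (fun f g e => exist _ (cmp (congr1 sval e : tgt (sval f) = src (sval g))) _)
    _ _ _ _ _ _ _.
Next Obligation. by move=> [f ff] i Di /=; rewrite -fsrc ff. Qed.
Next Obligation. by move=> [f ff] i Di /=; rewrite -ftgt ff. Qed.
Next Obligation. by move=> [x fx] i Di /=; rewrite fidm fx. Qed.
Next Obligation.
move=> [f ff] [g fg] e i Di; move: (congr1 _ e) => /= {}e.
have e' : tgt (fmor (F i) f) = src (fmor (F i) g) by rewrite ff ?fg.
rewrite (fcmp e e'); move: e'; rewrite ff // fg // => e'.
by congr cmp; exact: Prop_irrelevance.
Qed.
Next Obligation. by move=> [x fx]; apply: eq_sig_hprop => //=; rewrite src_idm. Qed.
Next Obligation. by move=> [x fx]; apply: eq_sig_hprop => //=; rewrite tgt_idm. Qed.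
Next Obligation. by move=> *; apply: eq_sig_hprop => //=; rewrite src_cmp. Qed.
Next Obligation. by move=> *; apply: eq_sig_hprop => //=; rewrite tgt_cmp. Qed.
Next Obligation. by move=> *; apply: eq_sig_hprop => //=; apply: cmp_idl. Qed.
Next Obligation. by move=> *; apply: eq_sig_hprop => //=; apply: cmp_idr. Qed.
Next Obligation. by move=> *; apply: eq_sig_hprop => //=; apply: cmp_assoc. Qed.
End Fixed.

Section FixedFunctor.
Variables (C C' : category) (I : Type) (D : set I).
Variables (F : I -> functor C C) (F' : I -> functor C' C') (H : functor C C').
Hypothesis Hob : forall i x, fob H (fob (F i) x) = fob (F' i) (fob H x).
Hypothesis Hmor : forall i f, fmor H (fmor (F i) f) = fmor (F' i) (fmor H f).

Program Definition fixed_functor : functor (fixed_cat D F) (fixed_cat D F') :=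
  @Functor (fixed_cat D F) (fixed_cat D F')
    (fun x => exist _ (fob H (sval x)) _) (fun f => exist _ (fmor H (sval f)) _)
    _ _ _ _.
Next Obligation. by move=> [x fx] i Di /=; rewrite -Hob fx. Qed.
Next Obligation. by move=> [f ff] i Di /=; rewrite -Hmor ff. Qed.
Next Obligation. by move=> *; apply: eq_sig_hprop => //=; apply: fsrc. Qed.
Next Obligation. by move=> *; apply: eq_sig_hprop => //=; apply: ftgt. Qed.
Next Obligation. by move=> *; apply: eq_sig_hprop => //=; apply: fidm. Qed.
Next Obligation. by move=> *; apply: eq_sig_hprop => //=; apply: fcmp. Qed.
End FixedFunctor.

Record gcat_operad_ops (gT : finGroupType) := GCatOperadOps {
  gc_cat : nat -> category;
  gcG : forall n, gT -> functor (gc_cat n) (gc_cat n);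
  gcS : forall n, Sym n -> functor (gc_cat n) (gc_cat n);
  gc1 : Ob (gc_cat 1);
  gcC : forall n (k : 'I_n -> nat),
    functor (prod_cat (gc_cat n) (pi_cat (fun i => gc_cat (k i))))
            (gc_cat (\sum_(i < n) k i))
}.

Definition gc_ob_ops gT (O : gcat_operad_ops gT) :
    operad_ops gT (fun n => Ob (gc_cat O n)) :=
  @OperadOps gT (fun n => Ob (gc_cat O n))
    (fun n g => fob (gcG O n g)) (fun n x s => fob (gcS O s) x) (gc1 O)
    (fun n k x y => fob (gcC O k) (x, y)).

Definition gc_mor_ops gT (O : gcat_operad_ops gT) :
    operad_ops gT (fun n => Mor (gc_cat O n)) :=
  @OperadOps gT (fun n => Mor (gc_cat O n))
    (fun n g => fmor (gcG O n g)) (fun n x s => fmor (gcS O s) x) (idm (gc1 O))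
    (fun n k x y => fmor (gcC O k) (x, y)).

(** The operad laws are equations between functors, hence equations between
    objects and equations between morphisms. *)
Record gcat_operad (gT : finGroupType) := GCatOperad {
  gc_ops :> gcat_operad_ops gT;
  gc_ob_laws : operad_laws (gc_ob_ops gc_ops);
  gc_mor_laws : operad_laws (gc_mor_ops gc_ops)
}.

Record operad_hom (gT : finGroupType) (X Y : nat -> Type)
    (oX : operad_ops gT X) (oY : operad_ops gT Y) (u : forall n, X n -> Y n) :
    Prop := OperadHom {
  hom_G : forall n g (x : X n), u n (opG oX g x) = opG oY g (u n x);
  hom_S : forall n (x : X n) s, u n (opS oX x s) = opS oY (u n x) s;
  hom_1 : u 1 (op1 oX) = op1 oY;
  hom_C : forall n (k : 'I_n -> nat) x (y : forall i, X (k i)),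
    u _ (opC oX x y) = opC oY (u n x) (fun i => u (k i) (y i))
}.

Record gcat_operad_map (gT : finGroupType) (N O : gcat_operad gT) :=
    GCatOperadMap {
  gm_functor : forall n, functor (gc_cat N n) (gc_cat O n);
  gm_ob : operad_hom (gc_ob_ops N) (gc_ob_ops O) (fun n => fob (gm_functor n));
  gm_mor : operad_hom (gc_mor_ops N) (gc_mor_ops O) (fun n => fmor (gm_functor n))
}.

Definition gc_act gT (O : gcat_operad gT) n (p : gT * Sym n) :
    functor (gc_cat O n) (gc_cat O n) :=
  comp_functor (gcS O p.2^-1%g) (gcG O n p.1).

Definition gc_fixed gT (O : gcat_operad gT) n (Gamma : {group gT * Sym n}) :
    category :=
  fixed_cat (fun p => p \in Gamma) (gc_act O (n := n)).

Section FixedMap.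
Variables (gT : finGroupType) (N O : gcat_operad gT) (u : gcat_operad_map N O).
Variables (n : nat) (Gamma : {group gT * Sym n}).

Fact gm_act_ob (p : gT * Sym n) x :
  fob (gm_functor u n) (fob (gc_act N p) x) =
  fob (gc_act O p) (fob (gm_functor u n) x).
Proof.
have /= HS := hom_S (gm_ob u); have /= HG := hom_G (gm_ob u).
by rewrite /= HS HG.
Qed.

Fact gm_act_mor (p : gT * Sym n) f :
  fmor (gm_functor u n) (fmor (gc_act N p) f) =
  fmor (gc_act O p) (fmor (gm_functor u n) f).
Proof.
have /= HS := hom_S (gm_mor u); have /= HG := hom_G (gm_mor u).
by rewrite /= HS HG.
Qed.

Definition gm_fixed : functor (gc_fixed N Gamma) (gc_fixed O Gamma) :=
  fixed_functor (fun p => p \in Gamma) gm_act_ob gm_act_mor.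
End FixedMap.

Section ChaoticOperad.
Variables (gT : finGroupType) (O : gset_operad gT).

Definition chaotic_ops : gcat_operad_ops gT :=
  @GCatOperadOps gT (fun n => chaotic (O n))
    (fun n g => chaotic_functor (opG (go_ops O) g))
    (fun n s => chaotic_functor (fun x : O n => opS (go_ops O) x s))
    (op1 (go_ops O))
    (fun n k => @Functor
      (prod_cat (chaotic (O n)) (pi_cat (fun i => chaotic (O (k i)))))
      (chaotic (O (\sum_(i < n) k i)))
      (fun x => opC (go_ops O) x.1 x.2)
      (fun f => (opC (go_ops O) f.1.1 (fun i => (f.2 i).1),
                 opC (go_ops O) f.1.2 (fun i => (f.2 i).2)))
      (fun=> erefl) (fun=> erefl) (fun=> erefl) (fun _ _ _ _ => erefl)).

Lemma tagged_pair m n (x1 x2 : O m) (y1 y2 : O n) :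
  Tagged O x1 = Tagged O y1 -> Tagged O x2 = Tagged O y2 ->
  Tagged (fun n => O n * O n)%type (x1, x2) = Tagged _ (y1, y2).
Proof.
move=> e1 e2; have e : m = n := congr1 tag e1.
case: _ / e y1 y2 e1 e2 => y1 y2 e1 e2.
by rewrite (eq_from_Tagged e1) (eq_from_Tagged e2).
Qed.

Lemma chaotic_ob_laws : operad_laws (gc_ob_ops chaotic_ops).
Proof. by case: (go_laws O). Qed.

Lemma chaotic_mor_laws : operad_laws (gc_mor_ops chaotic_ops).
Proof.
have L := go_laws O; split=> /=.
- by move=> n [x y]; rewrite !(opG_1 L).
- by move=> n g h [x y]; rewrite !(opG_M L).
- by move=> n [x y]; rewrite !(opS_1 L).
- by move=> n [x y] s t; rewrite !(opS_M L).
- by move=> n g [x y] s; rewrite !(opG_S L).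
- by move=> g; rewrite !(opG_op1 L).
- by move=> n k g [x y] z; rewrite !(opG_opC L).
- by move=> n [x y]; apply: tagged_pair; apply: (op_unitl L).
- by move=> n [x y]; apply: tagged_pair; apply: (op_unitr L).
- by move=> n k m [x y] z w; apply: tagged_pair; apply: (op_assoc L).
- move=> n k [x y] s z; apply: tagged_pair.
    exact: (@op_eqv_outer _ _ _ L _ _ _ _ (fun i => (z i).1)).
  exact: (@op_eqv_outer _ _ _ L _ _ _ _ (fun i => (z i).2)).
- by move=> n k [x y] z t; rewrite !(op_eqv_inner L).
Qed.

Definition chaotic_operad : gcat_operad gT :=
  GCatOperad chaotic_ob_laws chaotic_mor_laws.
End ChaoticOperad.

Section ChaoticMap.
Variables (gT : finGroupType) (N O : gset_operad gT).
Variables (u : forall n, N n -> O n).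
Hypothesis hom_u : operad_hom (go_ops N) (go_ops O) u.

Lemma chaotic_map_mor :
  operad_hom (gc_mor_ops (chaotic_operad N)) (gc_mor_ops (chaotic_operad O))
    (fun n => fmor (chaotic_functor (@u n))).
Proof.
split=> /=.
- by move=> n g x; rewrite !(hom_G hom_u).
- by move=> n x s; rewrite !(hom_S hom_u).
- by rewrite (hom_1 hom_u).
- by move=> n k x y; rewrite !(hom_C hom_u).
Qed.

Lemma chaotic_map_ob :
  operad_hom (gc_ob_ops (chaotic_operad N)) (gc_ob_ops (chaotic_operad O))
    (fun n => fob (chaotic_functor (@u n))).
Proof. by case: hom_u. Qed.

Definition chaotic_map : gcat_operad_map (chaotic_operad N) (chaotic_operad O) :=
  GCatOperadMap chaotic_map_ob chaotic_map_mor.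
End ChaoticMap.

Lemma subop_incl_hom gT (O : gset_operad gT) S (subS : @is_suboperad gT O S) :
  operad_hom (go_ops (suboperad subS)) (go_ops O) (fun n => sval).
Proof. by split. Qed.

Record gset (gT : finGroupType) := GSet {
  gs_sort :> finType;
  gs_act : gT -> gs_sort -> gs_sort;
  gs_act1 : forall x, gs_act 1%g x = x;
  gs_actM : forall g h x, gs_act (g * h)%g x = gs_act g (gs_act h x)
}.

Record ordered_gset (gT : finGroupType) := OrderedGSet {
  og_disp : Order.disp_t;
  og_sort :> finOrderType og_disp;
  og_act : gT -> og_sort -> og_sort;
  og_act1 : forall x, og_act 1%g x = x;
  og_actM : forall g h x, og_act (g * h)%g x = og_act g (og_act h x)
}.

Definition unordered gT (T : ordered_gset gT) : gset gT :=
  GSet (@og_act1 gT T) (@og_actM gT T).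

Definition gset_transitive gT (X : gset gT) : Prop :=
  inhabited X /\ forall x y : X, exists g, gs_act g x = y.

Definition gset_trivial gT (X : gset gT) : Prop :=
  forall g (x : X), gs_act g x = x.

Definition gset_iso gT (X Y : gset gT) : Prop :=
  exists2 u : X -> Y, bijective u & forall g x, u (gs_act g x) = gs_act g (u x).

(** [OO] is also allowed to contain one-point [gT]-sets, the norms of which are
    the operadic identity. *)
Definition complete_orbits gT (OO : ordered_gset gT -> Prop) : Prop :=
  (forall T, OO T -> gset_transitive (unordered T)) /\
  (forall X : gset gT, gset_transitive X -> ~ gset_trivial X ->
     exists! T, OO T /\ gset_iso (unordered T) X).

Section Norm.
Variables (gT : finGroupType) (T : ordered_gset gT).

(** [Order.enum_val i] is the [i]-th element of [T] in increasing order. *)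
Definition norm_fun (g : gT) (i : 'I_#|T|) : 'I_#|T| :=
  Order.enum_rank (og_act g (Order.enum_val i)).

Lemma norm_fun_inj g : injective (norm_fun g).
Proof.
move=> i j /Order.EnumVal.enum_rank_inj /(congr1 (@og_act _ T g^-1%g)).
by rewrite -!og_actM mulVg !og_act1 => /Order.EnumVal.enum_val_inj.
Qed.

Definition norm : PG gT #|T| := [ffun g => perm (@norm_fun_inj g) : Sym #|T|].
End Norm.

Definition trivial_ogset (gT : finGroupType) (n : nat) : ordered_gset gT :=
  @OrderedGSet gT _ 'I_n (fun _ x => x) (fun=> erefl) (fun _ _ _ => erefl).

(** The empty [gT]-set and the trivial [gT]-set [{0 < 1}] are represented by
    ['I_0] and ['I_2]. *)
Inductive norm_gens gT (OO : ordered_gset gT -> Prop) :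
    forall n, PG_operad gT n -> Prop :=
| NormOrbit T of OO T : norm_gens OO (norm T)
| NormEmpty : norm_gens OO (norm (trivial_ogset gT 0))
| NormTwo : norm_gens OO (norm (trivial_ogset gT 2)).

Definition QG_subop gT (OO : ordered_gset gT -> Prop) :=
  generated_suboperad (norm_gens OO).

Definition QG_operad gT (OO : ordered_gset gT -> Prop) : gset_operad gT :=
  suboperad (QG_subop OO).

Definition cat_PG gT : gcat_operad gT := chaotic_operad (PG_operad gT).
Definition cat_QG gT (OO : ordered_gset gT -> Prop) : gcat_operad gT :=
  chaotic_operad (QG_operad OO).
Definition cat_QG_incl gT (OO : ordered_gset gT -> Prop) :
    gcat_operad_map (cat_QG OO) (cat_PG gT) :=
  chaotic_map (subop_incl_hom (QG_subop OO)).

Program Definition ordinal_cat (n : nat) : category :=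
  @Category 'I_n.+1 {p : 'I_n.+1 * 'I_n.+1 | p.1 <= p.2}
    (fun f => (sval f).1) (fun f => (sval f).2)
    (fun i => exist _ (i, i) _)
    (fun f g e => exist _ ((sval f).1, (sval g).2) _) _ _ _ _ _ _ _.
Next Obligation. by move=> n i /=. Qed.
Next Obligation.
move=> n [[i j] /= le_ij] [[i' j'] /= le_ij'] /= e.
by apply: leq_trans le_ij _; rewrite e.
Qed.
Next Obligation. by []. Qed.
Next Obligation. by []. Qed.
Next Obligation. by []. Qed.
Next Obligation. by []. Qed.
Next Obligation. by move=> n [[i j] le_ij] e; apply: val_inj. Qed.
Next Obligation. by move=> n [[i j] le_ij] e; apply: val_inj. Qed.
Next Obligation. by move=> *; apply: val_inj. Qed.

Section Simplices.
Variable R : realType.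
Local Open Scope ring_scope.
Local Open Scope classical_set_scope.

Definition simplex (n : nat) : set {ptws 'I_n.+1 -> R} :=
  [set t | (forall i, 0 <= t i) /\ \sum_(i < n.+1) t i = 1].
Arguments simplex : clear implicits.

(** Monotone maps from [{0,...,m}] to [{0,...,n}] are the functors
    [ordinal_cat m -> ordinal_cat n]. *)
Definition simplex_push_fun m n (th : functor (ordinal_cat m) (ordinal_cat n))
    (t : 'I_m.+1 -> R) : 'I_n.+1 -> R :=
  fun j => \sum_(i < m.+1 | fob th i == j :> 'I_n.+1) t i.

Fact simplex_push_subproof m n (th : functor (ordinal_cat m) (ordinal_cat n))
    (t : {ptws 'I_m.+1 -> R}) :
  simplex m t -> simplex n (simplex_push_fun th t).
Proof.
move=> [t0 t1]; split=> [j|]; first exact: sumr_ge0.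
by rewrite -t1 [RHS](partition_big (fob th : 'I_m.+1 -> 'I_n.+1) xpredT).
Qed.

Definition simplex_push m n (th : functor (ordinal_cat m) (ordinal_cat n))
    (t : simplex m) : simplex n :=
  exist _ (simplex_push_fun th (\val t))
    (mem_set (simplex_push_subproof th (set_mem (valP t)))).

Variable C : category.

Definition nerve (n : nat) : Type := functor (ordinal_cat n) C.

Definition nerve_pull m n (x : nerve n)
  (th : functor (ordinal_cat m) (ordinal_cat n)) : nerve m := comp_functor x th.

(** The geometric realization of the nerve is the quotient of the disjoint
    union over [n] of the spaces [nerve n * simplex n] ([nerve n] discrete)
    by the relations [(x . th, t) ~ (x, th_* t)]. *)
Definition cell (n : nat) : topologicalType :=
  (discrete_topology {classic nerve n} * simplex n)%type.

Definition cells : topologicalType := {n : nat & cell n}.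

Definition mk_cell n (x : nerve n) (t : simplex n) : cells :=
  existT cell n (x, t).

Inductive glue : cells -> cells -> Prop :=
| Glue m n (th : functor (ordinal_cat m) (ordinal_cat n))
    (x : nerve n) (t : simplex m) :
    glue (mk_cell (nerve_pull x th) t) (mk_cell x (simplex_push th t)).

Definition glue_rel : rel cells :=
  fun p q => `[< clos_refl_sym_trans cells glue p q >].

Fact glue_refl : reflexive glue_rel.
Proof. by move=> p; apply/asboolP; exact: rst_refl. Qed.
Fact glue_sym : symmetric glue_rel.
Proof. by move=> p q; apply/asboolP/asboolP; exact: rst_sym. Qed.
Fact glue_trans : transitive glue_rel.
Proof. by move=> q p r /asboolP pq /asboolP qr; apply/asboolP; exact: rst_trans qr. Qed.

Definition glue_equiv : equiv_rel cells :=
  EquivRel glue_rel glue_refl glue_sym glue_trans.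

Definition classifying_space : topologicalType :=
  quotient_topology {eq_quot glue_equiv}%qT.

Definition to_classifying_space (p : cells) : classifying_space :=
  \pi_({eq_quot glue_equiv}%qT)%qT p.

Lemma to_classifying_space_eq p q :
  clos_refl_sym_trans cells glue p q ->
  to_classifying_space p = to_classifying_space q.
Proof. by move=> pq; apply/eqmodP/asboolP. Qed.
End Simplices.

Section ClassifyingMap.
Variables (R : realType) (C D : category) (F : functor C D).

Definition cells_map (p : cells R C) : cells R D :=
  let: existT n (x, t) := p in mk_cell (comp_functor F x) t.

Definition classifying_map (x : classifying_space R C) : classifying_space R D :=
  to_classifying_space (cells_map (repr (x : {eq_quot glue_equiv R C}%qT))).

Lemma classifying_mapE (p : cells R C) :
  classifying_map (to_classifying_space p) = to_classifying_space (cells_map p).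
Proof.
apply: to_classifying_space_eq.
have /eqmodP/asboolP : (repr (to_classifying_space p : {eq_quot glue_equiv R C}%qT)
  = p %[mod {eq_quot glue_equiv R C}])%qT by rewrite reprK.
move: (repr _) => p'; elim=> [_ _ [m n th x t]|q|q r _|q r s _ qr _ rs].
- apply: rst_step; rewrite /cells_map /=.
  have E : comp_functor F (nerve_pull x th) = nerve_pull (comp_functor F x) th.
    exact: functor_eq.
  by have := Glue th (comp_functor F x) t; rewrite -E.
- exact: rst_refl.
- exact: rst_sym.
- exact: rst_trans qr rs.
Qed.
End ClassifyingMap.

Section Homotopy.
Variable R : realType.
Local Open Scope ring_scope.
Local Open Scope classical_set_scope.

Definition unit_interval : topologicalType := (`[0, 1] : set R).

Fact I0_subproof : `[0, 1]%classic (0 : R).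
Proof. by rewrite /= in_itv /= lexx ler01. Qed.
Fact I1_subproof : `[0, 1]%classic (1 : R).
Proof. by rewrite /= in_itv /= lexx ler01. Qed.

Definition I0 : unit_interval := exist _ 0 (mem_set I0_subproof).
Definition I1 : unit_interval := exist _ 1 (mem_set I1_subproof).

Definition contractible (X : topologicalType) : Prop :=
  exists (x0 : X) (H : X * unit_interval -> X),
    [/\ continuous H, forall x, H (x, I0) = x & forall x, H (x, I1) = x0].

Definition path_related (X : topologicalType) (x y : X) : Prop :=
  exists p : unit_interval -> X, [/\ continuous p, p I0 = x & p I1 = y].

Definition cube (n : nat) : topologicalType := {ptws 'I_n -> unit_interval}.

Definition cube_boundary n (c : cube n) : Prop :=
  exists i : 'I_n, c i = I0 \/ c i = I1.

(** The elements of [pi_n (X, x)] are the classes of the maps satisfying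
    [sphere_map x] for the relation [sphere_homotopic x]; bijectivity on
    [pi_n] is stated below in terms of representatives. *)
Definition sphere_map (X : topologicalType) (x : X) n (u : cube n -> X) : Prop :=
  continuous u /\ forall c, cube_boundary c -> u c = x.

Definition sphere_homotopic (X : topologicalType) (x : X) n (u v : cube n -> X) :
    Prop :=
  exists H : cube n * unit_interval -> X,
    [/\ continuous H, forall c, H (c, I0) = u c, forall c, H (c, I1) = v c &
        forall c s, cube_boundary c -> H (c, s) = x].

Record weak_homotopy_equivalence (X Y : topologicalType) (f : X -> Y) : Prop :=
    WeakHomotopyEquivalence {
  whe_continuous : continuous f;
  whe_pi0_inj : forall x x', path_related (f x) (f x') -> path_related x x';
  whe_pi0_surj : forall y, exists x, path_related (f x) y;
  whe_pi_inj : forall n (x : X) (u v : cube n.+1 -> X),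
    sphere_map x u -> sphere_map x v ->
    sphere_homotopic (f x) (f \o u) (f \o v) -> sphere_homotopic x u v;
  whe_pi_surj : forall n (x : X) (w : cube n.+1 -> Y),
    sphere_map (f x) w ->
    exists2 u, sphere_map x u & sphere_homotopic (f x) (f \o u) w
}.

End Homotopy.

Definition operad_equivalence (R : realType) gT (N O : gcat_operad gT)
    (u : gcat_operad_map N O) : Prop :=
  forall n (Gamma : {group gT * Sym n}),
    weak_homotopy_equivalence R (classifying_map (R := R) (gm_fixed u Gamma)).

Definition E_infty_operad (R : realType) gT (O : gcat_operad gT) : Prop :=
  forall n (Gamma : {group gT * Sym n}),
    let X := classifying_space R (gc_fixed O Gamma) in
    let free := (Gamma :&: finset.setX [1 gT] [set: Sym n] = 1)%g in
    (free -> contractible R X) /\ (~ free -> ~ inhabited X).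

(* Main.v *)
(** An element of [P_G(n)^Gamma] is a function [f] with [f (h g) = f h * s] for
    all [(g, s)] in [Gamma]; taking [g = 1], it can only exist when [Gamma]
    meets [1 * Sigma_n] trivially.  In that case [Gamma] is the graph of a
    homomorphism on a subgroup [H] of [G], that is, an [H]-set structure on
    [{1,...,n}].  This [H]-set embeds [H]-equivariantly in a finite disjoint
    union of orbits of [G], each isomorphic to a member of [OO] or trivial:
    send [g.r], for [r] a chosen representative of an [H]-orbit, to [g.t] for
    a point [t] of stabilizer [Stab_H(r)] in the [r]-th copy.  The block sum of
    the norms of these orbits lies in [Q_G], and inserting the nullary
    operation outside of the image of the embedding gives a [Gamma]-fixed
    point of [Q_G(n)].

    The fixed categories are indiscrete, and the cone on a vertex contracts the
    classifying space of a nonempty indiscrete category.  A continuous map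
    between contractible spaces is a weak equivalence. *)

From Stdlib Require Import Relations.
From mathcomp Require Import all_boot all_order all_algebra all_fingroup.
From mathcomp Require Import generic_quotient.
From mathcomp Require Import boolp classical_sets reals topology normedtype.
From mathcomp Require Import lra.
Require Import Defs.

Set Implicit Arguments.
Unset Strict Implicit.
Unset Printing Implicit Defensive.

Import Order.TTheory GRing.Theory Num.Theory.
Import numFieldNormedType.Exports.

(** * Continuity *)

Section ExponentialLaw.
Import ArrowAsCompactOpen.
Local Open Scope classical_set_scope.
Variables (V W : topologicalType).
Hypotheses (lcV : locally_compact [set: V]) (regV : regular_space V).

(** The product of a quotient map with a fixed space need not be a quotient map. Currying gets
    around this: a map from a quotient to the mapping space from [V] to [W] is tested before the
    quotient, and uncurrying uses that [V] is locally compact and regular. *)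
Lemma quotient_prod_continuous (T : topologicalType) (Q : quotType T)
    (H : quotient_topology Q * V -> W) :
  continuous (fun p : T * V => H ((\pi_Q p.1)%qT : quotient_topology Q, p.2)) ->
  continuous H.
Proof.
move=> /continuous_curry[cH cHv].
have -> : H = uncurry (curry H) by rewrite curryK.
apply: continuous_uncurry_regular => // [|u].
  apply/quotient_continuous.
  have -> : \pi_(quotient_topology Q)%qT = \pi_Q%qT :> (T -> quotient_topology Q).
    by rewrite unlock.
  exact: cH.
rewrite -[u](@reprK _ Q) => v; exact: (cHv (repr (u : Q)) v).
Qed.

(** Same currying argument, a map out of a disjoint union being tested on each summand. *)
Lemma sigT_prod_continuous (I : choiceType) (X : I -> topologicalType)
    (H : {i & X i} * V -> W) :
  (forall i, continuous (fun p : X i * V => H (existT X i p.1, p.2))) ->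
  continuous H.
Proof.
move=> cH.
have -> : H = uncurry (curry H) by rewrite curryK.
apply: continuous_uncurry_regular => // [|[i u]].
  by move=> [i x]; exact: ((continuous_curry (cH i)).1 x).
by have [_] := continuous_curry (cH i); apply.
Qed.
End ExponentialLaw.

Section UnitInterval.
Variable R : realType.
Local Open Scope ring_scope.
Local Open Scope classical_set_scope.

Local Notation I := (unit_interval R).

Lemma continuous_ptws (Z : topologicalType) (J : Type) (Y : topologicalType)
    (f : Z -> {ptws J -> Y}) :
  (forall j, continuous (fun z => f z j)) -> continuous f.
Proof.
by move=> cf z; apply/cvg_sup => j; apply: continuous_comp_initial; exact: cf.
Qed.

Lemma continuous_set_type (Z X : topologicalType) (A : set X) (f : Z -> A) :
  continuous (fun z => \val (f z) : X) -> continuous f.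
Proof. exact: continuous_comp_initial. Qed.

Lemma continuous_val (X : topologicalType) (A : set X) :
  continuous (fun a : A => \val a : X).
Proof. exact: initial_continuous. Qed.

Definition ival (a : I) : R := \val a.

Lemma ival_continuous : continuous ival.
Proof. exact: initial_continuous. Qed.

Lemma ival_inj : injective ival. Proof. exact: val_inj. Qed.

Lemma unit_interval_ge0 (a : I) : 0 <= ival a.
Proof. by rewrite /ival; case: a => a /=; rewrite inE /= in_itv /= => /andP[]. Qed.

Lemma unit_interval_le1 (a : I) : ival a <= 1.
Proof. by rewrite /ival; case: a => a /=; rewrite inE /= in_itv /= => /andP[]. Qed.

Fact clamp_subproof (x : R) : `[0, 1]%classic (Num.max 0 (Num.min x 1)).
Proof.
by rewrite /= in_itv /= le_max lexx ge_max ler01 ge_min lexx orbT.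
Qed.

(** Retraction of the line onto the interval. Homotopies are written as [clamp] of a real formula,
    so their terms carry no bound proofs. *)
Definition clamp (x : R) : I :=
  exist _ (Num.max 0 (Num.min x 1)) (mem_set (clamp_subproof x)).

Lemma ival_clamp x : 0 <= x <= 1 -> ival (clamp x) = x.
Proof. by move=> /andP[x0 x1]; rewrite /ival /= (min_idPl x1) (max_idPr x0). Qed.

Lemma clamp_val (a : I) : clamp (ival a) = a.
Proof.
apply: ival_inj; rewrite ival_clamp//.
by rewrite unit_interval_ge0 unit_interval_le1.
Qed.

Lemma clamp_le0 x : x <= 0 -> clamp x = I0 R.
Proof. by move=> x0; apply: val_inj; rewrite /= (max_idPl _)// ge_min x0. Qed.

Lemma clamp_ge1 x : 1 <= x -> clamp x = I1 R.
Proof. by move=> x1; apply: val_inj; rewrite /= (min_idPr x1) (max_idPr _). Qed.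

Lemma clamp_continuous : continuous clamp.
Proof.
apply: continuous_set_type => x.
apply: (@continuous_max R R (fun=> 0) (fun x => Num.min x 1)); first exact: cvg_cst.
by apply: (@continuous_min R R id (fun=> 1)); [exact: cvg_id | exact: cvg_cst].
Qed.

Lemma unit_interval_compact : compact [set: I].
Proof.
have -> : [set: I] = clamp @` `[0, 1].
  apply/seteqP; split=> // a _; exists (ival a); last exact: clamp_val.
  by rewrite /= in_itv /= unit_interval_ge0 unit_interval_le1.
apply: continuous_compact; last exact: segment_compact.
exact/continuous_subspaceT/clamp_continuous.
Qed.

Lemma unit_interval_locally_compact : locally_compact [set: I].
Proof.
move=> x _; rewrite withinET; exists setT => //; first exact: filterT.
by split; [exact: unit_interval_compact | exact: closedT].
Qed.

Lemma unit_interval_regular : regular_space I.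
Proof. exact: uniform_regular. Qed.

Lemma ival0 : ival (I0 R) = 0. Proof. by []. Qed.
Lemma ival1 : ival (I1 R) = 1. Proof. by []. Qed.
End UnitInterval.

Lemma continuous_compT (X Y Z : topologicalType) (g : Y -> Z) (f : X -> Y) :
  continuous g -> continuous f -> continuous (fun x => g (f x)).
Proof. by move=> cg cf x; apply: continuous_comp; [exact: cf | exact: cg]. Qed.

Lemma continuous_pair (X Y Z : topologicalType) (f : X -> Y) (g : X -> Z) :
  continuous f -> continuous g -> continuous (fun x => (f x, g x)).
Proof. by move=> cf cg x; apply: cvg_pair; [exact: cf | exact: cg]. Qed.

Lemma continuous_fst (X Y : topologicalType) : continuous (fst : X * Y -> X).
Proof. by move=> x; exact: cvg_fst. Qed.

Lemma continuous_snd (X Y : topologicalType) : continuous (snd : X * Y -> Y).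
Proof. by move=> x; exact: cvg_snd. Qed.

Lemma continuous_cst (X Y : topologicalType) (y : Y) : continuous ((fun=> y) : X -> Y).
Proof. by move=> x; exact: cvg_cst. Qed.

Lemma eq_continuous (X Y : topologicalType) (f g : X -> Y) :
  f =1 g -> continuous f -> continuous g.
Proof. by move=> /funext->. Qed.

Section RealValued.
Variables (R : realType) (X : topologicalType).
Local Open Scope ring_scope.
Implicit Types f g : X -> R.

Lemma continuous_add f g :
  continuous f -> continuous g -> continuous (fun x => f x + g x).
Proof. by move=> cf cg x; apply: cvgD; [exact: cf | exact: cg]. Qed.

Lemma continuous_sub f g :
  continuous f -> continuous g -> continuous (fun x => f x - g x).
Proof. by move=> cf cg x; apply: cvgB; [exact: cf | exact: cg]. Qed.

Lemma continuous_mul f g :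
  continuous f -> continuous g -> continuous (fun x => f x * g x).
Proof. by move=> cf cg x; apply: cvgM; [exact: cf | exact: cg]. Qed.

Lemma continuous_cadd (a : R) f : continuous f -> continuous (fun x => a + f x).
Proof. exact: (@continuous_add (fun=> a) f (@continuous_cst _ _ _)). Qed.

Lemma continuous_addc f (a : R) : continuous f -> continuous (fun x => f x + a).
Proof. by move=> cf; exact: (@continuous_add f (fun=> a) cf (@continuous_cst _ _ _)). Qed.

Lemma continuous_csub (a : R) f : continuous f -> continuous (fun x => a - f x).
Proof. exact: (@continuous_sub (fun=> a) f (@continuous_cst _ _ _)). Qed.

Lemma continuous_cmul (a : R) f : continuous f -> continuous (fun x => a * f x).
Proof. exact: (@continuous_mul (fun=> a) f (@continuous_cst _ _ _)). Qed.

Lemma continuous_prod (J : Type) (r : seq J) (F : J -> X -> R) :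
  (forall j, continuous (F j)) -> continuous (fun x => \prod_(j <- r) F j x).
Proof.
move=> cF; elim: r => [|j r IH].
  by under eq_fun do rewrite big_nil; exact: continuous_cst.
by under eq_fun do rewrite big_cons; exact: continuous_mul.
Qed.
End RealValued.

(** * Contractible spaces *)

Section Contractible.
Variable R : realType.
Local Open Scope ring_scope.
Local Open Scope classical_set_scope.

Local Notation I := (unit_interval R).

(** Concatenation of homotopies at double speed. The last clause, that no new values appear over a
    given [z], is what keeps a homotopy constant on the boundary of a cube. *)
Lemma concat_continuous (Z X : topologicalType) (A B : Z * I -> X) :
  continuous A -> continuous B -> (forall z, A (z, I1 R) = B (z, I0 R)) ->
  exists C : Z * I -> X, [/\ continuous C, forall z, C (z, I0 R) = A (z, I0 R),
    forall z, C (z, I1 R) = B (z, I1 R) &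
    forall z s, exists s', C (z, s) = A (z, s') \/ C (z, s) = B (z, s')].
Proof.
move=> cA cB AB.
pose A' (p : Z * I) := A (p.1, clamp (2 * ival p.2)).
pose B' (p : Z * I) := B (p.1, clamp (2 * ival p.2 - 1)).
pose C p := if ival p.2 <= 1 / 2 then A' p else B' p.
have cv : continuous (fun p : Z * I => ival p.2).
  exact: (continuous_compT (@ival_continuous R) (@continuous_snd _ _)).
have c2v : continuous (fun p : Z * I => 2 * ival p.2).
  exact: continuous_cmul cv.
have cA' : continuous A'.
  apply: continuous_compT cA _; apply: continuous_pair; first exact: continuous_fst.
  exact: continuous_compT (@clamp_continuous R) c2v.
have cB' : continuous B'.
  apply: continuous_compT cB _; apply: continuous_pair; first exact: continuous_fst.
  apply: continuous_compT (@clamp_continuous R) _.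
  exact: continuous_addc c2v.
have clL : closed [set p : Z * I | ival p.2 <= 1 / 2 ].
  exact: (@preimage_closed _ _ _ [set r : R | r <= 1 / 2] (fun p _ => cv p)
    (@closed_le R (1 / 2))).
have clU : closed [set p : Z * I | 1 / 2 <= ival p.2 ].
  exact: (@preimage_closed _ _ _ [set r : R | 1 / 2 <= r] (fun p _ => cv p)
    (@closed_ge R (1 / 2))).
exists C; split.
- have := @withinU_continuous _ _ _ _ C clL clU.
  have -> : [set p : Z * I | ival p.2 <= 1 / 2 ] `|`
            [set p : Z * I | 1 / 2 <= ival p.2 ] = setT.
    by apply/seteqP; split => // p _ /=; apply/orP; exact: le_total.
  move=> H; apply/continuous_subspace_setT; apply: H.
    apply: (@subspace_eq_continuous _ _ _ A').
      by move=> p; rewrite inE /from_subspace /C /= => ->.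
    exact: continuous_subspaceT.
  apply: (@subspace_eq_continuous _ _ _ B').
    move=> p; rewrite inE /from_subspace /C /= => p1; case: ifPn => // p2.
    (* On the overlap [C] is [A'] by definition; there the two parameters are clamped to the ends
       [I1] and [I0], where [AB] applies. *)
    have e : ival p.2 = 1 / 2 by apply/eqP; rewrite eq_le p1 p2.
    apply/esym; rewrite /A' /B' e clamp_ge1 ?clamp_le0 ?AB//; lra.
  exact: continuous_subspaceT.
- move=> z; rewrite /C /A' /= ival0 ifT; last lra.
  by rewrite clamp_le0//; lra.
- move=> z; rewrite /C /B' /= ival1 ifF; last by apply/negbTE; rewrite -ltNge; lra.
  by rewrite clamp_ge1//; lra.
- move=> z s; rewrite /C; case: ifP => _; first by eexists; left.
  by eexists; right.
Qed.

Section Contraction.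
Variables (X : topologicalType) (x0 : X) (G : X * I -> X).
Hypotheses (cG : continuous G) (G0 : forall x, G (x, I0 R) = x)
  (G1 : forall x, G (x, I1 R) = x0).

Let rev (a : I) : I := clamp (1 - ival a).

Let rev_continuous : continuous rev.
Proof.
apply: continuous_compT (@clamp_continuous R) _.
exact: continuous_csub (@ival_continuous R).
Qed.

Let rev0 : rev (I0 R) = I1 R. Proof. by rewrite /rev ival0 clamp_ge1// subr0. Qed.
Let rev1 : rev (I1 R) = I0 R. Proof. by rewrite /rev ival1 clamp_le0// subrr. Qed.

(** Follow the contraction from [x] to [x0], then that of [y] backwards. The parameter space of the
    concatenation is a dummy copy of [X]. *)
Lemma contraction_path_related (x y : X) : path_related R x y.
Proof.
have [||z|C [cC C0 C1 _]] := @concat_continuous X X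
  (fun p => G (x, p.2)) (fun p => G (y, rev p.2)).
- by apply: continuous_compT cG _; apply: continuous_pair;
    [exact: continuous_cst | exact: continuous_snd].
- apply: continuous_compT cG _; apply: continuous_pair; first exact: continuous_cst.
  exact: continuous_compT rev_continuous (@continuous_snd _ _).
- by rewrite /= rev0 !G1.
exists (fun s => C (x, s)); split.
- apply: continuous_compT cC _; apply: continuous_pair; first exact: continuous_cst.
  by move=> s; exact: cvg_id.
- by rewrite C0 G0.
- by rewrite C1 /= rev1 G0.
Qed.

Section Spheres.
Variable n : nat.
Local Notation cube := (cube R n).

(** Dilation about the centre of the cube, clamped in each coordinate. At time 1 the factor is 3, so
    only the open middle-third cube stays off the boundary. *)
Let expand (p : cube * I) : cube :=
  fun i => clamp (1 / 2 + (ival (p.1 i) - 1 / 2) * (1 + 2 * ival p.2)).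

(** Cutoff function: 0 on the boundary, 1 on the middle-third cube. *)
Let bump (c : cube) : R :=
  \prod_(i < n) (ival (clamp (3 * ival (c i))) * ival (clamp (3 * (1 - ival (c i))))).

Let val_coord_continuous (i : 'I_n) : continuous (fun c : cube => ival (c i)).
Proof.
apply: continuous_compT (@ival_continuous R) _.
by move=> c; exact: proj_continuous.
Qed.

Let expand_continuous : continuous expand.
Proof.
apply: continuous_ptws => i; apply: continuous_compT (@clamp_continuous R) _.
apply: continuous_cadd; apply: continuous_mul.
  apply: continuous_addc.
  exact: continuous_compT (@val_coord_continuous i) (@continuous_fst _ _).
apply: continuous_cadd; apply: continuous_cmul.
exact: continuous_compT (@ival_continuous R) (@continuous_snd _ _).
Qed.

Let bump_continuous : continuous bump.
Proof.
apply: continuous_prod => i; apply: continuous_mul;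
  apply: continuous_compT (@ival_continuous R) _;
  apply: continuous_compT (@clamp_continuous R) _;
  apply: continuous_cmul _ => //.
exact: continuous_csub (@val_coord_continuous _).
Qed.

Let bump_boundary c : cube_boundary c -> bump c = 0.
Proof.
move=> [i ci]; rewrite /bump (bigD1 i)//=.
case: ci => ->; rewrite ?ival0 ?ival1.
  by rewrite (clamp_le0 (x := 3 * 0)) ?mulr0// ival0 !mul0r.
by rewrite (_ : clamp (3 * (1 - 1)) = I0 R)
  ?ival0 ?mulr0 ?mul0r// clamp_le0// subrr mulr0.
Qed.

Let expand_boundary c s : cube_boundary c -> cube_boundary (expand (c, s)).
Proof.
move=> [i ci]; exists i; rewrite /expand /=.
have s0 := unit_interval_ge0 s.
(* An end coordinate goes to [- s] or [1 + s], which clamping returns to the same end. *)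
by case: ci => ->; rewrite ?ival0 ?ival1;
  [left; rewrite clamp_le0 | right; rewrite clamp_ge1] => //; nra.
Qed.

Let expand0 c : expand (c, I0 R) = c.
Proof.
apply/funext => i; rewrite /expand /= ival0 -[RHS]clamp_val; congr clamp; lra.
Qed.

Let expand1 c : ~ cube_boundary (expand (c, I1 R)) -> bump c = 1.
Proof.
move=> nb; rewrite /bump big1// => i _.
(* A coordinate outside the open middle third would be sent to an end by the factor 3; inside it
   both factors of the bump are clamped to 1. *)
have [le|lt] := leP (ival (c i)) (1 / 3).
  by case: nb; exists i; left; rewrite /expand /= ival1 clamp_le0//; lra.
have [le'|lt'] := leP (2 / 3) (ival (c i)).
  by case: nb; exists i; right; rewrite /expand /= ival1 clamp_ge1//; lra.
by rewrite !clamp_ge1 ?ival1 ?mulr1//; lra.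
Qed.

(* Expanding the cube while contracting, with a speed that vanishes on the
   boundary, turns [u] into a map which depends only on the base point. *)
Lemma contraction_sphere (x : X) (u : cube -> X) : sphere_map x u ->
  sphere_homotopic x u (fun c => G (x, clamp (bump c))).
Proof.
move=> [cu ux].
exists (fun p => G (u (expand p), clamp (ival p.2 * bump p.1))); split.
- apply: continuous_compT cG _; apply: continuous_pair.
    exact: continuous_compT cu expand_continuous.
  apply: continuous_compT (@clamp_continuous R) _; apply: continuous_mul.
    exact: continuous_compT (@ival_continuous R) (@continuous_snd _ _).
  exact: continuous_compT bump_continuous (@continuous_fst _ _).
- by move=> c; rewrite expand0 /= ival0 mul0r clamp_le0.
- move=> c; rewrite /= ival1 mul1r.
  (* If the dilated point is on the boundary, [u] takes the value [x] there; otherwise the bump is 1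
     and both sides equal [x0]. *)
  have [/ux-> //|/expand1->] := pselect (cube_boundary (expand (c, I1 R))).
  by rewrite clamp_ge1// !G1.
- move=> c s bc; rewrite /= ux; last exact: expand_boundary.
  by rewrite bump_boundary// mulr0 clamp_le0.
Qed.
End Spheres.

(** Both maps deform to the same map, which depends only on [x]; the second deformation is run
    backwards. *)
Lemma contraction_sphere_homotopic n (x : X) (u v : cube R n -> X) :
  sphere_map x u -> sphere_map x v -> sphere_homotopic x u v.
Proof.
move=> /contraction_sphere[A [cA A0 A1 Ax]] /contraction_sphere[B [cB B0 B1 Bx]].
have [|c|C [cC C0 C1 CAB]] := concat_continuous cA (B := fun p => B (p.1, rev p.2)).
- apply: continuous_compT cB _; apply: continuous_pair; first exact: continuous_fst.
  exact: continuous_compT rev_continuous (@continuous_snd _ _).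
- by rewrite /= rev0 A1 B1.
exists C; split => //.
- by move=> c; rewrite C0.
- by move=> c; rewrite C1 /= rev1.
- by move=> c s bc; have [s' [->|->]] := CAB c s; rewrite ?Ax ?Bx.
Qed.
End Contraction.

(** All points are joined by paths and all sphere maps at a base point are homotopic, so constant
    maps serve as lifts. *)
Lemma contractible_weak_equivalence (X Y : topologicalType) (f : X -> Y) :
  contractible R X -> contractible R Y -> continuous f ->
  weak_homotopy_equivalence R f.
Proof.
move=> [x0 [G [cG G0 G1]]] [y0 [H [cH H0 H1]]] cf; split=> //.
- by move=> x x' _; exact: contraction_path_related cG G0 G1 _ _.
- by move=> y; exists x0; exact: contraction_path_related cH H0 H1 _ _.
- by move=> n x u v ux vx _; exact: contraction_sphere_homotopic cG G0 G1 _ _ _ _ ux vx.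
- move=> n x w wx; have cx : sphere_map x ((fun=> x) : cube R n.+1 -> X).
    by split=> //; exact: continuous_cst.
  exists (fun=> x) => //; apply: contraction_sphere_homotopic cH H0 H1 _ _ _ _ _ wx.
  by split=> //; exact: continuous_cst.
Qed.

(** For the subgroups without fixed points: the source is empty too and every clause is vacuous. *)
Lemma empty_weak_equivalence (X Y : topologicalType) (f : X -> Y) :
  ~ inhabited Y -> weak_homotopy_equivalence R f.
Proof.
move=> Y0; have X0 (x : X) : False by apply: Y0; split; exact: f x.
split=> [x|x|y|n x|n x]; try by case: (X0 x).
by case: Y0; split.
Qed.
End Contractible.

(** * Classifying spaces of indiscrete categories *)

Lemma sigT_continuous (I : choiceType) (X : I -> topologicalType)
    (Z : topologicalType) (f : {i & X i} -> Z) :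
  (forall i, continuous (fun x : X i => f (existT X i x))) -> continuous f.
Proof. by move=> cf [i x]; exact: cf. Qed.

Section Cells.
Variables (R : realType) (C : category).

Lemma to_classifying_space_continuous :
  continuous (@to_classifying_space R C).
Proof.
apply/continuousP => A; rewrite /open /= /quotient_open /to_classifying_space.
by rewrite unlock.
Qed.

Lemma classifying_space_ind (P : classifying_space R C -> Prop) :
  (forall p, P (to_classifying_space p)) -> forall x, P x.
Proof.
move=> H x; rewrite -[x](@reprK _ {eq_quot glue_equiv R C}%qT); exact: H.
Qed.

Lemma continuous_mk_cell (Z : topologicalType) n
    (a : Z -> discrete_topology {classic nerve C n}) (t : Z -> @simplex R n) :
  continuous a -> continuous t ->
  continuous (fun z => mk_cell (a z : nerve C n) (t z) : cells R C).
Proof.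
move=> ca ct.
exact: (continuous_compT (@existT_continuous _ (cell R C) n) (continuous_pair ca ct)).
Qed.
End Cells.

Lemma continuous_discrete (X : topologicalType) (T : choiceType)
    (f : discrete_topology T -> X) : continuous f.
Proof.
by apply/continuousP => A _; exact: discrete_open.
Qed.
Arguments continuous_discrete : clear implicits.

(** Tested on each cell before the quotient, where the nerve factor is discrete and the simplex
    coordinate is unchanged. *)
Lemma classifying_map_continuous (R : realType) (C D : category) (F : functor C D) :
  continuous (classifying_map (R := R) F).
Proof.
apply/quotient_continuous.
have -> : classifying_map F \o \pi_(classifying_space R C)%qT =
    (fun p => to_classifying_space (cells_map F p)).
  apply/funext => p; rewrite -classifying_mapE /= /to_classifying_space.
  by rewrite [in LHS]unlock [in RHS]unlock.
apply: continuous_compT (@to_classifying_space_continuous R D) _.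
apply: sigT_continuous => n.
have -> : (fun x : cell R C n => cells_map F (existT (cell R C) n x)) =
    (fun x => mk_cell (comp_functor F x.1) x.2) by apply/funext => -[].
apply: continuous_mk_cell; last exact: continuous_snd.
apply: continuous_compT (@continuous_fst _ _).
exact: (continuous_discrete _ {classic nerve C n}).
Qed.

(** * Cones over simplices of a nerve *)

Definition ord_functor m n (th : 'I_m.+1 -> 'I_n.+1)
  (th_homo : {homo th : i j / (i <= j)%N}) : functor (ordinal_cat m) (ordinal_cat n).
Proof.
exists th (fun f => exist _ (th (sval f).1, th (sval f).2) (th_homo _ _ (svalP f))).
- by [].
- by [].
- by move=> i; apply: val_inj.
- by move=> f g e e'; apply: val_inj.
Defined.

Lemma ord_functor_homo m n (th : functor (ordinal_cat m) (ordinal_cat n)) :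
  {homo (fob th : 'I_m.+1 -> 'I_n.+1) : i j / (i <= j)%N}.
Proof.
move=> i j ij; pose f : Mor (ordinal_cat m) := exist _ (i, j) ij.
have := svalP (fmor th f).
have /= -> := fsrc th f; have /= -> := ftgt th f; exact.
Qed.

(** One operation for the three ingredients of a cone: vertices in the nerve, barycentric
    coordinates and monotone maps. *)
Definition cons_ord (T : Type) (y : T) n (o : 'I_n.+1 -> T) (j : 'I_n.+2) : T :=
  oapp o y (unlift ord0 j).

Lemma cons_ord0 T (y : T) n (o : 'I_n.+1 -> T) : cons_ord y o ord0 = y.
Proof. by rewrite /cons_ord unlift_none. Qed.

Lemma cons_ordS T (y : T) n (o : 'I_n.+1 -> T) i : cons_ord y o (lift ord0 i) = o i.
Proof. by rewrite /cons_ord liftK. Qed.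

Definition cons_map m n (th : 'I_m.+1 -> 'I_n.+1) : 'I_m.+2 -> 'I_n.+2 :=
  cons_ord ord0 (lift ord0 \o th).

Lemma cons_map_homo m n (th : 'I_m.+1 -> 'I_n.+1) :
  {homo th : i j / (i <= j)%N} -> {homo cons_map th : i j / (i <= j)%N}.
Proof.
move=> H i j; rewrite /cons_map.
case: (unliftP ord0 i) => [i'|] ->; case: (unliftP ord0 j) => [j'|] ->;
  rewrite ?cons_ord0 ?cons_ordS //= /bump !add1n ltnS; exact: H.
Qed.

(** Stated without reference to [chaotic], so that it applies to fixed subcategories, whose objects
    and morphisms are subtypes. *)
Definition indiscrete (C : category) : Prop :=
  exists hom : Ob C -> Ob C -> Mor C,
    [/\ forall x y, src (hom x y) = x, forall x y, tgt (hom x y) = y &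
      forall f g : Mor C, src f = src g -> tgt f = tgt g -> f = g].

Section IndiscreteNerve.
Variables (C : category).
Variable (hom : Ob C -> Ob C -> Mor C).
Hypotheses (hom_src : forall x y, src (hom x y) = x)
  (hom_tgt : forall x y, tgt (hom x y) = y)
  (hom_uniq : forall f g : Mor C, src f = src g -> tgt f = tgt g -> f = g).

(** In an indiscrete category any sequence of objects spans a simplex, which it determines by
    [nerve_eq]. *)
Definition nerve_of n (o : 'I_n.+1 -> Ob C) : nerve C n.
Proof.
exists o (fun f : Mor (ordinal_cat n) => hom (o (src f)) (o (tgt f))).
- by move=> f; rewrite hom_src.
- by move=> f; rewrite hom_tgt.
- by move=> x; apply: hom_uniq; rewrite ?hom_src ?hom_tgt ?src_idm ?tgt_idm.
- move=> f g e e'; apply: hom_uniq.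
    by rewrite hom_src !src_cmp hom_src.
  by rewrite hom_tgt !tgt_cmp hom_tgt.
Defined.

Lemma nerve_eq n (x y : nerve C n) : fob x =1 fob y -> x = y.
Proof.
by move=> e; apply: functor_eq => // f; apply: hom_uniq; rewrite ?fsrc ?ftgt e.
Qed.

Variable R : realType.
Local Open Scope ring_scope.
Local Open Scope classical_set_scope.
Local Notation I := (unit_interval R).

Fact join_subproof n (t : {ptws 'I_n.+1 -> R}) (s : I) : @simplex R n t ->
  @simplex R n.+1 (cons_ord (ival s) (fun i => (1 - ival s) * t i)).
Proof.
have s0 := unit_interval_ge0 s; have s1 := unit_interval_le1 s.
move=> [t0 t1]; split=> [j|].
  case: (unliftP ord0 j) => [i|] ->; rewrite ?cons_ord0 ?cons_ordS //.
  by apply: mulr_ge0; [rewrite subr_ge0 | exact: t0].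
rewrite big_ord_recl cons_ord0.
under eq_bigr do rewrite cons_ordS.
by rewrite -mulr_sumr t1 mulr1 addrC subrK.
Qed.

(** Point at parameter [s] on the segment from [t], placed in the face opposite to vertex 0, to
    vertex 0. *)
Definition join n (t : @simplex R n) (s : I) : @simplex R n.+1 :=
  exist _ (cons_ord (ival s) (fun i => (1 - ival s) * \val t i))
    (mem_set (join_subproof s (set_mem (valP t)))).

Lemma join_continuous n : continuous (fun p : @simplex R n * I => join p.1 p.2).
Proof.
apply: continuous_set_type; apply: continuous_ptws => j.
have cs : continuous (fun p : @simplex R n * I => ival p.2).
  exact: continuous_compT (@ival_continuous R) (@continuous_snd _ _).
case: (unliftP ord0 j) => [i|] ->; rewrite /join /=.
  apply: (eq_continuous (f := fun p : @simplex R n * I => (1 - ival p.2) * \val p.1 i)).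
    by move=> p; rewrite cons_ordS.
  apply: continuous_mul; first exact: continuous_csub cs.
  have cv : continuous (fun t : @simplex R n => \val t i).
    apply: (@continuous_compT _ {ptws 'I_n.+1 -> R} R (fun v => v i)).
      by move=> v; exact: proj_continuous.
    exact: continuous_val.
  exact: continuous_compT cv (@continuous_fst _ _).
by apply: eq_continuous cs => p; rewrite cons_ord0.
Qed.

Lemma simplex_eq n (t u : @simplex R n) : (forall i, \val t i = \val u i) -> t = u.
Proof. by move=> e; apply: val_inj; apply/funext. Qed.

Variable c : Ob C.

Definition cone_cell (p : cells R C) (s : I) : cells R C :=
  let: existT n (x, t) := p in
  mk_cell (nerve_of (cons_ord c (fob (x : nerve C n)))) (join t s).

(** Coning is natural: gluing along [th] becomes gluing along its extension that fixes the cone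
    vertex. *)
Lemma cone_cell_glue (p q : cells R C) s :
  glue p q -> glue (cone_cell p s) (cone_cell q s).
Proof.
case=> m n th x t; rewrite /cone_cell /mk_cell.
have Hth := ord_functor_homo th.
have -> : nerve_of (cons_ord c (fob (nerve_pull x th))) =
    nerve_pull (nerve_of (cons_ord c (fob x))) (ord_functor (cons_map_homo Hth)).
  apply: nerve_eq => j /=; rewrite /cons_map.
  by case: (unliftP ord0 j) => [i|] ->; rewrite ?cons_ord0 ?cons_ordS.
have -> : join (simplex_push th t) s =
    simplex_push (ord_functor (cons_map_homo Hth)) (join t s).
  apply: simplex_eq => j /=.
  set F := ord_functor (cons_map_homo Hth).
  have F0 : fob F ord0 = ord0 by exact: cons_ord0.
  have FS l : fob F (lift ord0 l) = lift ord0 (fob th l) by exact: cons_ordS.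
  (* The push-forward depends only on the values of [F] on objects, given by [F0] and [FS]; its body
     is forgotten. *)
  move: F F0 FS => F F0 FS.
  rewrite /simplex_push_fun big_mkcond big_ord_recl F0 cons_ord0 /=.
  case: (unliftP ord0 j) => [i|] ->; rewrite ?cons_ord0 ?cons_ordS.
    rewrite (negbTE (neq_lift _ _)) add0r mulr_sumr big_mkcond.
    by apply: eq_bigr => l _; rewrite FS cons_ordS (inj_eq lift_inj).
  rewrite eqxx big1 ?addr0// => l _.
  by rewrite FS cons_ordS eq_sym (negbTE (neq_lift _ _)).
exact: Glue.
Qed.

(** The cone vertex has weight 0, so the point lies on the opposite face, which is the original
    simplex; the gluing is along the coface that skips 0. *)
Lemma cone_cell0 p :
  to_classifying_space (cone_cell p (I0 R)) = to_classifying_space p.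
Proof.
case: p => n [x t]; apply: to_classifying_space_eq.
have H : {homo lift (@ord0 n.+1) : i j / (i <= j)%N}.
  by move=> i j; rewrite /= /bump !add1n ltnS.
apply: rst_sym; apply: rst_step.
have -> : cone_cell (existT (cell R C) n (x, t)) (I0 R) = mk_cell
    (nerve_of (cons_ord c (fob (x : nerve C n)))) (simplex_push (ord_functor H) t).
  congr mk_cell; apply: simplex_eq => j /=; rewrite /simplex_push_fun /=.
  case: (unliftP ord0 j) => [i|] ->; rewrite ?cons_ord0 ?cons_ordS.
    rewrite (bigD1 i)//= big1 ?addr0 ?subr0 ?mul1r// => l /andP[].
    by rewrite (inj_eq lift_inj) => /eqP->; rewrite eqxx.
  by rewrite big1// => l; rewrite eq_sym (negbTE (neq_lift _ _)).
have -> : existT (cell R C) n (x, t) = mk_cell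
    (nerve_pull (nerve_of (cons_ord c (fob (x : nerve C n)))) (ord_functor H)) t.
  congr mk_cell; apply: nerve_eq => j /=; by rewrite cons_ordS.
exact: Glue.
Qed.

Fact simplex0_subproof : @simplex R 0 (fun=> 1).
Proof. by split=> [i|]; rewrite ?ler01 ?big_ord1. Qed.

Definition simplex0 : @simplex R 0 := exist _ (fun=> 1) (mem_set simplex0_subproof).

Definition vertex : cells R C := mk_cell (nerve_of (fun _ : 'I_1 => c)) simplex0.

(** All the weight is on the cone vertex; the gluing is along the inclusion of vertex 0. *)
Lemma cone_cell1 p :
  to_classifying_space (cone_cell p (I1 R)) = to_classifying_space vertex.
Proof.
case: p => n [x t]; apply: to_classifying_space_eq.
have H : {homo (fun=> ord0) : i j / ((i : 'I_1) <= j)%N >-> ((i : 'I_n.+2) <= j)%N}.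
  by [].
apply: rst_sym; apply: rst_step.
have -> : vertex = mk_cell
    (nerve_pull (nerve_of (cons_ord c (fob (x : nerve C n)))) (ord_functor H))
    simplex0.
  by congr mk_cell; apply: nerve_eq => j /=; rewrite cons_ord0.
have -> : cone_cell (existT (cell R C) n (x, t)) (I1 R) = mk_cell
    (nerve_of (cons_ord c (fob (x : nerve C n))))
    (simplex_push (ord_functor H) simplex0).
  congr mk_cell; apply: simplex_eq => j /=; rewrite /simplex_push_fun /=.
  case: (unliftP ord0 j) => [i|] ->; rewrite ?cons_ord0 ?cons_ordS.
    by rewrite subrr mul0r big_pred0// => l; rewrite (negbTE (neq_lift _ _)).
  by rewrite big_ord1_cond eqxx.
exact: Glue.
Qed.

Definition cone (p : classifying_space R C * I) : classifying_space R C :=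
  to_classifying_space (cone_cell (repr (p.1 : {eq_quot glue_equiv R C}%qT)) p.2).

(** Coning preserves the gluing relation, hence the equivalence it generates, so the representative
    does not matter. *)
Lemma coneE p s :
  cone (to_classifying_space p, s) = to_classifying_space (cone_cell p s).
Proof.
rewrite /cone /=; apply: to_classifying_space_eq.
have /eqmodP/asboolP : (repr (to_classifying_space p : {eq_quot glue_equiv R C}%qT)
  = p %[mod {eq_quot glue_equiv R C}])%qT by rewrite reprK.
move: (repr _) => q; elim=> [a b|a|a b _|a b d _ ab _ bd].
- by move=> /(cone_cell_glue s); exact: rst_step.
- exact: rst_refl.
- exact: rst_sym.
- exact: rst_trans ab bd.
Qed.

Lemma cone_continuous : continuous cone.
Proof.
apply: quotient_prod_continuous; [exact: unit_interval_locally_compact|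
  exact: unit_interval_regular|].
have -> : (fun p : cells R C * I => cone
    ((\pi_({eq_quot glue_equiv R C}) p.1)%qT : classifying_space R C, p.2)) =
    (fun p => to_classifying_space (cone_cell p.1 p.2)).
  by apply/funext => p; exact: coneE.
apply: continuous_compT (@to_classifying_space_continuous R C) _.
apply: sigT_prod_continuous; [exact: unit_interval_locally_compact|
  exact: unit_interval_regular|] => n.
have -> : (fun p : cell R C n * I => cone_cell (existT (cell R C) n p.1) p.2) =
    (fun p => mk_cell (nerve_of (cons_ord c (fob (p.1.1 : nerve C n)))) (join p.1.2 p.2)).
  by apply/funext => -[[x t] s].
apply: continuous_mk_cell.
  apply: (@continuous_compT _ _ _ (fun x : discrete_topology {classic nerve C n} =>
    nerve_of (cons_ord c (fob (x : nerve C n))) :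
      discrete_topology {classic nerve C n.+1}) (fun p : cell R C n * I => p.1.1)).
    exact: (continuous_discrete _ {classic nerve C n}).
  exact: continuous_compT (@continuous_fst _ _) (@continuous_fst _ _).
apply: (@continuous_compT _ _ _ (fun p : @simplex R n * I => join p.1 p.2)
  (fun p : cell R C n * I => (p.1.2, p.2))); first exact: join_continuous.
apply: continuous_pair; last exact: continuous_snd.
exact: continuous_compT (@continuous_snd _ _) (@continuous_fst _ _).
Qed.
End IndiscreteNerve.

Lemma indiscrete_contractible (R : realType) (C : category) :
  indiscrete C -> Ob C -> contractible R (classifying_space R C).
Proof.
move=> [hom [hs ht hu]] c.
exists (to_classifying_space (@vertex C hom hs ht hu R c)), (@cone C hom hs ht hu R c).
split; first exact: cone_continuous.
- by elim/classifying_space_ind => p; rewrite coneE cone_cell0.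
- by elim/classifying_space_ind => p; rewrite coneE cone_cell1.
Qed.

(** * Fixed points in the operad generated by the norms *)

Section Combinatorics.
Variable gT : finGroupType.
Local Notation PG := (PG gT).

Section Restriction.
Variables (S : forall n, set (PG_operad gT n)) (subS : is_suboperad S).

(** The norm of the trivial [gT]-set with [n] points, see [norm_trivial]. *)
Definition const1 n : PG n := [ffun=> 1%g].

Lemma opC_const1 n (k : 'I_n -> nat) :
  opC (PG_ops gT) (const1 n) (fun i => const1 (k i)) = const1 (\sum_(i < n) k i).
Proof.
apply/ffunP => h; rewrite !ffunE -[RHS]sym_comp1; congr sym_comp.
by apply/functional_extensionality_dep => i; rewrite ffunE.
Qed.

(** Induction: [const1 2] composed with the operadic identity and [const1 n] is [const1 n.+1]. *)
Lemma subop_const1 : S (const1 0) -> S (const1 2) -> forall n, S (const1 n).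
Proof.
move=> S0 S2; elim=> [//|n Sn].
pose k (i : 'I_2) := if i == ord0 then 1%N else n.
have : S (const1 (\sum_(i < 2) k i)).
  rewrite -opC_const1; apply: (subop_C subS) S2 _ => i.
  by rewrite /k; case: (i == ord0) => //; exact: (subop_1 subS).
by rewrite big_ord_recl big_ord1.
Qed.

Hypothesis S1 : forall n, S (const1 n).

(** The arity of a composite is a sum, only provably equal to [n]; hence [m = n] as a hypothesis and
    values compared in [nat]. *)
Lemma subop_perm m n (f : PG m) (kap : 'I_n -> 'I_m) : m = n -> injective kap ->
  S f -> exists2 f' : PG n, S f' & forall h i, f' h i = f h (kap i) :> nat.
Proof.
move=> e; case: _ / e kap => kap inj Sf.
exists (opS (PG_ops gT) f (perm inj : Sym m)).
  exact: (subop_S subS (perm inj : Sym m) Sf).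
by move=> h i; rewrite /= ffunE symME permE.
Qed.

(* Composing with nullary operations deletes the inputs outside of the image
   of [iota]. *)
Lemma subop_restrict m n (f : PG m) (iota : 'I_n -> 'I_m) : injective iota ->
  S f -> exists2 f' : PG n, S f' &
    forall h i j, (f' h i < f' h j) = (f h (iota i) < f h (iota j)).
Proof.
move=> inj Sf; pose k (p : 'I_m) : nat := p \in codom iota.
have k1 i : k (iota i) = 1%N by rewrite /k codom_f.
pose g := opC (PG_ops gT) f (fun p => const1 (k p)).
have Sg : S g by apply: (subop_C subS) => // p; exact: S1.
pose kap i : 'I_(\sum_p k p) := tagnat.Rank (iota i) (cast_ord (esym (k1 i)) ord0).
have kap_inj : injective kap.
  move=> i j; rewrite /kap => E; apply: inj.
  by rewrite -(tagnat.Rank1K (cast_ord (esym (k1 i)) ord0)) E tagnat.Rank1K.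
have e : \sum_p k p = n.
  rewrite -[RHS](card_ord n) -(card_codom inj) -sum1_card [RHS]big_mkcond /=.
  by apply: eq_bigr => p _; rewrite /k; case: (p \in _).
have [f' Sf' f'E] := subop_perm e kap_inj Sg.
(* [g h] places a surviving input by counting the survivors that [f h] puts before it. *)
have gE h i : g h (kap i) = block_off k (f h) (iota i) :> nat.
  by rewrite /g /= ffunE sym_compE ffunE sym1E.
have lt h i j : f h (iota i) < f h (iota j) -> f' h i < f' h j.
  by move=> /(block_off_le k); rewrite !f'E !gE k1 addn1.
exists f' => // h i j; apply/idP/idP; last exact: lt.
(* The converse follows from [lt] by totality of the order and injectivity. *)
apply: contraTT; rewrite -!leqNgt leq_eqVlt => /orP[|/lt/ltnW//].
by rewrite val_eqE (inj_eq perm_inj) (inj_eq inj) => /eqP->.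
Qed.
End Restriction.

(** The value at [i] is the number of smaller values, so relative order determines a permutation. *)
Lemma sym_lt_inj n (s t : Sym n) :
  (forall i j, (s i < s j) = (t i < t j)) -> s = t.
Proof.
move=> E; apply/permP => i; apply: ord_inj.
have rank (u : Sym n) : \sum_(l < n | u l < u i) 1 = u i.
  rewrite (reindex_inj (@perm_inj _ u^-1%g)) /=.
  rewrite (eq_bigl (fun l : 'I_n => l < u i)) => [|l]; last by rewrite symKV.
  by rewrite -(big_ord_widen _ (fun=> 1%N)) ?sum1_card ?card_ord// ltnW.
by rewrite -[LHS]rank -[RHS]rank; apply: eq_bigl => l; rewrite E.
Qed.
End Combinatorics.

(** * Orbits as coset spaces *)

Section Cosets.
Variables (gT : finGroupType) (K : {group gT}).
Local Open Scope group_scope.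

Let coset_type : finType := {A : {set gT} | A \in lcosets K [set: gT]}.

Fact lcoset_act_subproof (g : gT) (A : coset_type) :
  g *: sval A \in lcosets K [set: gT].
Proof.
case: A => A /= /lcosetsP[x _ ->]; apply/lcosetsP.
by exists (g * x); rewrite ?inE// lcosetM.
Qed.

Definition lcoset_act (g : gT) (A : coset_type) : coset_type :=
  exist _ (g *: sval A) (lcoset_act_subproof g A).

Definition coset_gset : gset gT.
Proof.
apply: (@GSet gT coset_type lcoset_act).
- by move=> A; apply: val_inj; rewrite /= lcoset1.
- by move=> g h A; apply: val_inj; rewrite /= lcosetM.
Defined.

Fact base_coset_subproof : (K : {set gT}) \in lcosets K [set: gT].
Proof. by apply/lcosetsP; exists 1; rewrite ?lcoset1 ?inE. Qed.

Definition base_coset : coset_gset := exist _ (K : {set gT}) base_coset_subproof.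

Lemma base_coset_stab g : gs_act g base_coset = base_coset <-> g \in K.
Proof.
split=> [/(congr1 sval)/= <-|gK]; first exact: lcoset_refl.
by apply: val_inj; rewrite /= lcoset_id.
Qed.

Lemma coset_gset_transitive : gset_transitive coset_gset.
Proof.
split=> [|[A HA] [B HB]]; first by split; exact: base_coset.
have /lcosetsP[x _ eA] := HA; have /lcosetsP[y _ eB] := HB.
exists (y * x^-1); apply: val_inj.
by rewrite /= eA eB -lcosetM mulgKV.
Qed.

Lemma coset_gset_nontrivial : (K : {set gT}) != [set: gT]%SET ->
  ~ gset_trivial coset_gset.
Proof.
move=> /eqP KT triv; apply: KT; apply/setP => g.
by rewrite inE; apply/base_coset_stab; exact: triv.
Qed.
End Cosets.

(** * Construction of a fixed point from norms *)

Section Norms.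
Variables (gT : finGroupType) (OO : ordered_gset gT -> Prop).
Hypothesis complete : complete_orbits OO.

Let QG n : set (PG_operad gT n) := @generated gT (PG_operad gT) (norm_gens OO) n.
Let subQ : is_suboperad QG := QG_subop OO.

Lemma QG_gen n (f : PG gT n) : norm_gens OO f -> QG f.
Proof. by move=> Hf S subS; apply. Qed.

Lemma norm_trivial n : norm (trivial_ogset gT n) = const1 gT #|'I_n|.
Proof.
apply/ffunP => h; rewrite !ffunE; apply/permP => i.
by rewrite permE sym1E /norm_fun Order.EnumVal.enum_valK.
Qed.

Lemma QG_const1 n : QG (const1 gT n).
Proof.
apply: (subop_const1 subQ).
  by have := QG_gen (NormEmpty OO); rewrite norm_trivial card_ord.
by have := QG_gen (NormTwo OO); rewrite norm_trivial card_ord.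
Qed.

(** For [K] the whole group a one-point set is used; otherwise the member of [OO] isomorphic to the
    cosets of [K]. Set and point are paired so that [choice] picks both. *)
Lemma orbit_with_stabilizer (K : {group gT}) :
  exists Tx : {T : ordered_gset gT & T}, QG (norm (tag Tx)) /\
    forall g, og_act g (tagged Tx) = tagged Tx <-> g \in K.
Proof.
have [KT|KT] := eqVneq (K : {set gT}) [set: gT]%SET.
  exists (existT _ (trivial_ogset gT 1) (ord0 : 'I_1)); split=> [|g].
    by rewrite /= norm_trivial; exact: QG_const1.
  by split; rewrite // KT inE.
have [T [[OT [u [v uK vK] uE]] _]] :=
  complete.2 _ (coset_gset_transitive K) (coset_gset_nontrivial KT).
have uE' g y : u (og_act g y) = gs_act g (u y) := uE g y.
exists (existT _ T (v (base_coset K))); split=> [|g].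
  exact: QG_gen (NormOrbit OT).
rewrite -base_coset_stab /=; split=> [e|e].
  by have := congr1 u e; rewrite uE' !vK.
by rewrite -[LHS]uK uE' vK [gs_act _ _]e.
Qed.

Section FixedPoint.
Variables (n : nat) (Gamma : {group gT * Sym n}).
Local Open Scope group_scope.
Hypothesis free : Gamma :&: finset.setX [1 gT] [set: Sym n] = 1.

(** [p * q^-1] has first component 1, so freeness kills it: [Gamma] is the graph of a
    homomorphism. *)
Let free_eq p q : p \in Gamma -> q \in Gamma -> p.1 = q.1 -> p = q.
Proof.
move=> pG qG e; apply/eqP; rewrite eq_mulgV1; apply/eqP/set1gP; rewrite -free.
by rewrite finset.inE groupM ?groupV//= finset.in_setX !inE /= e mulgV eqxx.
Qed.

(** Orbit representative. The unit of [Gamma] makes [i] itself a candidate, so the default is never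
    reached. *)
Let rep (i : 'I_n) : 'I_n :=
  odflt i [pick j | [exists p in Gamma, p.2 j == i]].

Let repP i : exists p, p \in Gamma /\ p.2 (rep i) = i.
Proof.
rewrite /rep; case: pickP => [j /exists_inP[p pG /eqP pj]|/(_ i)/exists_inP[]].
  by exists p.
by exists 1; rewrite ?group1// sym1E.
Qed.

Let rep_act p i : p \in Gamma -> rep (p.2 i) = rep i.
Proof.
move=> pG; rewrite /rep.
have -> : [pick j | [exists q in Gamma, q.2 j == p.2 i]] =
          [pick j | [exists q in Gamma, q.2 j == i]].
  apply: eq_pick => j; apply/exists_inP/exists_inP => -[q qG /eqP qj].
    by exists (p^-1 * q); rewrite ?groupM ?groupV//= symME qj symVK.
  by exists (p * q); rewrite ?groupM//= symME qj.
(* The two sides have different defaults, so a failing pick must be excluded. *)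
case: pickP => //= /(_ i)/exists_inP[].
by exists 1; rewrite ?group1// sym1E.
Qed.

(** Stabilizer of [j] for the action that [Gamma] defines on ['I_n] of its projection to [gT]. *)
Let stab_set (j : 'I_n) : {set gT} :=
  [set g | [exists p in Gamma, (p.1 == g) && (p.2 j == j)]].

Fact stab_group_set j : group_set (stab_set j).
Proof.
apply/group_setP; split=> [|g h].
  by rewrite inE; apply/exists_inP; exists 1; rewrite ?group1//= sym1E !eqxx.
rewrite !inE => /exists_inP[p pG /andP[/eqP<- /eqP pj]].
move=> /exists_inP[q qG /andP[/eqP<- /eqP qj]].
by apply/exists_inP; exists (p * q); rewrite ?groupM//= symME qj pj !eqxx.
Qed.

Lemma norm_fixed_point : exists2 f : PG gT n, QG f &
  forall p, p \in Gamma -> opS (PG_ops gT) (opG (PG_ops gT) p.1 f) p.2^-1 = f.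
Proof.
have [s sP] := choice repP.
have [Tx TxP] := choice (fun j => orbit_with_stabilizer (Group (stab_group_set j))).
(* One orbit is taken for every [j], representative or not; whatever [iota] misses is deleted at the
   end. *)
pose k j := #|tag (Tx j)|.
pose F := opC (PG_ops gT) (const1 gT n) (fun j => norm (tag (Tx j))) :
  PG gT (\sum_j k j).
have QF : QG F.
  by apply: (subop_C subQ) => [|j]; [exact: QG_const1 | have [] := TxP j].
pose point j g : 'I_(\sum_j k j) :=
  tagnat.Rank j (Order.enum_rank (og_act g (tagged (Tx j)))).
have FE h j g : F h (point j g) = point j (h * g).
  apply: ord_inj; rewrite /F /= ffunE sym_compE [RHS]tagnat.RankEsum.
  rewrite !ffunE block_off1 addnC; congr (_ + _)%N.
  by rewrite permE /norm_fun Order.EnumVal.enum_rankK og_actM.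
have pointP j g g' : point j g = point j g' <-> g^-1 * g' \in stab_set j.
  rewrite /point /stab_set -[_ \in _](_ : g^-1 * g' \in Group (stab_group_set j) = _)//.
  rewrite -(TxP j).2 og_actM; split=> [/(congr1 val)/= /eqP|e].
    rewrite tagnat.eq_Rank => /andP[_ /eqP/val_inj].
    by move=> /Order.EnumVal.enum_rank_inj <-; rewrite -og_actM mulVg og_act1.
  by have := congr1 (og_act g) e; rewrite -og_actM mulgV og_act1 => ->.
(* [s i] carries [rep i] to [i], so [i] goes to the translate by [(s i).1] of the chosen point. *)
pose iota i := point (rep i) (s i).1.
have iota_inj : injective iota.
  move=> i j E; have r : rep i = rep j.
    by have := congr1 (@tagnat.sig1 _ _) E; rewrite !tagnat.Rank1K.
  have [iG ri] := sP i; have [jG rj] := sP j.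
  move: E; rewrite /iota -r => /pointP; rewrite inE => /exists_inP[q qG].
  move=> /andP[/eqP q1 /eqP q2].
  have sj : s j = s i * q by apply: free_eq; rewrite ?groupM//= q1 mulKVg.
  by rewrite -[LHS]ri -[RHS]rj -r sj symME q2.
have FG h p i : p \in Gamma -> F (h * p.1) (iota i) = F h (iota (p.2 i)).
  move=> pG; rewrite /iota !FE rep_act//; apply/pointP.
  have [iG ri] := sP i; have [pjG rpi] := sP (p.2 i).
  (* This element carries [rep i] to [p.2 i], then to [i], then back to [rep i]. *)
  rewrite inE; apply/exists_inP; exists ((s i)^-1 * (p^-1 * s (p.2 i))).
    by rewrite !groupM ?groupV.
  rewrite rep_act// in rpi.
  by rewrite !invMg !mulgA mulgKV /= !eqxx !symME rpi symVK -{2}ri symVK eqxx.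
have [f Qf fE] := subop_restrict subQ QG_const1 iota_inj QF.
exists f => // p pG.
(* Restriction only controls the relative order of the values of [f], which suffices by
   [sym_lt_inj]. *)
have fp h : f (h * p.1) = f h * p.2.
  by apply: sym_lt_inj => i j; rewrite !symME !fE !FG.
by apply/ffunP => h; rewrite !ffunE fp mulgK.
Qed.
End FixedPoint.
End Norms.

(** * Fixed-point categories *)

Section FixedCategories.
Variables (gT : finGroupType) (n : nat) (Gamma : {group gT * Sym n}).

Lemma chaotic_fixed_indiscrete (O : gset_operad gT) :
  indiscrete (gc_fixed (chaotic_operad O) Gamma).
Proof.
pose D := gc_fixed (chaotic_operad O) Gamma.
have fixP (x y : Ob D) p : p \in Gamma ->
    fmor (gc_act (chaotic_operad O) p) (sval x, sval y) = (sval x, sval y).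
  by move=> pG; rewrite -[in RHS](svalP x p pG) -[in RHS](svalP y p pG).
exists (fun x y => exist _ (sval x, sval y) (fixP x y)); split.
- by move=> x y; apply: eq_sig_hprop.
- by move=> x y; apply: eq_sig_hprop.
- move=> [[f1 f2] ff] [[g1 g2] gg] /(congr1 sval)/= e1 /(congr1 sval)/= e2.
  by apply: eq_sig_hprop => //=; rewrite e1 e2.
Qed.

Lemma PG_free_of_fixed :
  Ob (gc_fixed (cat_PG gT) Gamma) ->
  (Gamma :&: finset.setX [1 gT] [set: Sym n] = 1)%g.
Proof.
move=> [f fix_f]; apply/trivgP/fintype.subsetP => -[g s].
rewrite finset.inE finset.in_setX => /andP[Hgs /andP[/set1gP /= g1 _]].
apply/set1gP; congr pair => //=.
have /= := congr1 (fun F : PG gT n => F 1%g) (fix_f _ Hgs).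
rewrite !ffunE g1 /= mulg1 => e.
by apply: invg_inj; apply: (mulgI (f 1%g)); rewrite e invg1 mulg1.
Qed.

Lemma classifying_space_inhabited (R : realType) (C : category) :
  inhabited (classifying_space R C) -> inhabited (Ob C).
Proof.
move=> [x]; elim/classifying_space_ind: x => -[m [x _]].
by split; exact: (fob (x : nerve C m) ord0).
Qed.

Lemma QG_fixed_object (OO : ordered_gset gT -> Prop) : complete_orbits OO ->
  (Gamma :&: finset.setX [1 gT] [set: Sym n] = 1)%g ->
  inhabited (Ob (gc_fixed (cat_QG OO) Gamma)).
Proof.
move=> complete free; have [f Qf ff] := norm_fixed_point complete free.
split; exists (exist _ f Qf) => p pG; apply: subop_eq; exact: ff.
Qed.
End FixedCategories.

Theorem theorem3p4 (R : realType) (gT : finGroupType)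
    (OO : ordered_gset gT -> Prop) :
  complete_orbits OO ->
  E_infty_operad R (cat_QG OO) /\ operad_equivalence R (cat_QG_incl OO).
Proof.
move=> complete; split=> n Gamma.
  split=> [free|nfree /classifying_space_inhabited[x]].
    have [x] := QG_fixed_object complete free.
    exact: indiscrete_contractible (chaotic_fixed_indiscrete _ _) x.
  by apply: nfree; exact: (PG_free_of_fixed (fob (gm_fixed (cat_QG_incl OO) Gamma) x)).
have [free|nfree] := pselect (Gamma :&: finset.setX [1 gT] [set: Sym n] = 1)%g.
  have [x] := QG_fixed_object complete free.
  apply: contractible_weak_equivalence; last exact: classifying_map_continuous.
    exact: indiscrete_contractible (chaotic_fixed_indiscrete _ _) x.
  apply: indiscrete_contractible (chaotic_fixed_indiscrete _ _) _.
  exact: (fob (gm_fixed (cat_QG_incl OO) Gamma) x).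
by apply: empty_weak_equivalence => /classifying_space_inhabited[/PG_free_of_fixed].
Qed.
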